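(* For every bsi-rule system $\mathtt{L}$, $\mathtt{L}$ is Kripke complete if and only if $\tau\mathtt{L}:=\mathtt{S4.t_R}\oplus\{T(\Gamma/\Delta):\Gamma/\Delta\in\mathtt{L}\}$ is Kripke complete.
   Context: Bsi-rule systems: rule systems (sets of pairs $\Gamma/\Delta$ of finite sets of formulae closed under substitution, reflexivity, weakening on both sides and cut) over $\{\land,\lor,\to,\leftarrow,\bot,\top\}$ containing $/\varphi$ for all theorems of bi-intuitionistic logic $\mathtt{bi\text{-}IPC}$, $\varphi,\varphi\to\psi/\psi$, $\varphi/\neg(\varphi\leftarrow\top)$. Tense rule systems: rule systems over $\{\land,\lor,\neg,\square_F,\lozenge_P,\bot,\top\}$ containing $/\varphi$ for all $\varphi\in\mathtt{S4.t}$ (least normal tense logic with $\mathtt{S4}$ for $\square_F$ and $\square_P=\neg\lozenge_P\neg$, and $\varphi\to\square_F\lozenge_P\varphi$), and the rules $\varphi,\varphi\to\psi/\psi$, $\varphi/\square_F\varphi$, $\varphi/\square_P\varphi$; $\mathtt{S4.t_R}$ is the least, $\oplus$ the least tense rule system containing given sets. Translation $T$: $T(p)=\square_Fp$, $T(\bot)=\bot$, $T(\top)=\top$, commutes with $\land,\lor$, $T(\varphi\to\psi)=\square_F(\neg T\varphi\lor T\psi)$, $T(\varphi\leftarrow\psi)=\lozenge_P(T\varphi\land\neg T\psi)$, $T(\Gamma/\Delta)=T[\Gamma]/T[\Delta]$. Bsi formulae are interpreted on Kripke frames that are posets $(X,\le)$ with valuations into upsets, $\to$ interpreted intuitionistically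 and $x\models\varphi\leftarrow\psi$ iff some $y\le x$ has $y\models\varphi$, $y\not\models\psi$. Tense formulae are interpreted on Kripke frames $(X,R)$ with $\square_F$ via $R$ and $\lozenge_P$ via the converse of $R$. A rule is valid on a frame if for every valuation, if every premise holds at all points then some conclusion holds at all points. A rule system is Kripke complete if it equals the set of rules valid on some class of Kripke frames.
   Formalization: Bsi-rule systems are required to contain φ/¬(⊤←φ) instead of the printed φ/¬(φ←⊤), which is vacuous and makes the claim false (local bi-IPC consequence); S4.t is taken with both converse axioms, φ→□_F◇_Pφ and φ→□_P◇_Fφ. *)

(* Defs.v *)
From HB Require Import structures.
From mathcomp Require Import all_boot.
From mathcomp Require Import finmap.
From Corelib Require Relations.Relation_Definitions.

Set Implicit Arguments.
Unset Strict Implicit.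
Unset Printing Implicit Defensive.

Local Open Scope fset_scope.

(** * Formulae *)

(** [BCoimp a b] is [a <- b], "a but not b". *)
Inductive bform : Type :=
| BVar of nat | BBot | BTop
| BAnd of bform & bform
| BOr of bform & bform
| BImp of bform & bform
| BCoimp of bform & bform.

Inductive tform : Type :=
| TVar of nat | TBot | TTop
| TAnd of tform & tform
| TOr of tform & tform
| TNeg of tform
| TBoxF of tform
| TDiaP of tform.

(* Encodings into generic trees, only used to make [{fset _}] available. *)
Fixpoint bform_encode (a : bform) : GenTree.tree nat :=
  match a with
  | BVar p => GenTree.Leaf p
  | BBot => GenTree.Node 0 [::]
  | BTop => GenTree.Node 1 [::]
  | BAnd a b => GenTree.Node 2 [:: bform_encode a; bform_encode b]
  | BOr a b => GenTree.Node 3 [:: bform_encode a; bform_encode b]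
  | BImp a b => GenTree.Node 4 [:: bform_encode a; bform_encode b]
  | BCoimp a b => GenTree.Node 5 [:: bform_encode a; bform_encode b]
  end.

Fixpoint bform_decode (t : GenTree.tree nat) : bform :=
  match t with
  | GenTree.Leaf p => BVar p
  | GenTree.Node 1 _ => BTop
  | GenTree.Node 2 [:: a; b] => BAnd (bform_decode a) (bform_decode b)
  | GenTree.Node 3 [:: a; b] => BOr (bform_decode a) (bform_decode b)
  | GenTree.Node 4 [:: a; b] => BImp (bform_decode a) (bform_decode b)
  | GenTree.Node 5 [:: a; b] => BCoimp (bform_decode a) (bform_decode b)
  | _ => BBot
  end.

Lemma bform_encodeK : cancel bform_encode bform_decode.
Proof. by elim=> //= a -> b ->. Qed.

HB.instance Definition _ := Countable.copy bform (can_type bform_encodeK).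

Fixpoint tform_encode (a : tform) : GenTree.tree nat :=
  match a with
  | TVar p => GenTree.Leaf p
  | TBot => GenTree.Node 0 [::]
  | TTop => GenTree.Node 1 [::]
  | TAnd a b => GenTree.Node 2 [:: tform_encode a; tform_encode b]
  | TOr a b => GenTree.Node 3 [:: tform_encode a; tform_encode b]
  | TNeg a => GenTree.Node 4 [:: tform_encode a]
  | TBoxF a => GenTree.Node 5 [:: tform_encode a]
  | TDiaP a => GenTree.Node 6 [:: tform_encode a]
  end.

Fixpoint tform_decode (t : GenTree.tree nat) : tform :=
  match t with
  | GenTree.Leaf p => TVar p
  | GenTree.Node 1 _ => TTop
  | GenTree.Node 2 [:: a; b] => TAnd (tform_decode a) (tform_decode b)
  | GenTree.Node 3 [:: a; b] => TOr (tform_decode a) (tform_decode b)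
  | GenTree.Node 4 [:: a] => TNeg (tform_decode a)
  | GenTree.Node 5 [:: a] => TBoxF (tform_decode a)
  | GenTree.Node 6 [:: a] => TDiaP (tform_decode a)
  | _ => TBot
  end.

Lemma tform_encodeK : cancel tform_encode tform_decode.
Proof. by elim=> //= [a -> b ->|a -> b ->|a ->|a ->|a ->]. Qed.

HB.instance Definition _ := Countable.copy tform (can_type tform_encodeK).

Definition BNeg (a : bform) := BImp a BBot.

Definition TImp (a b : tform) := TOr (TNeg a) b.
Definition TDiaF (a : tform) := TNeg (TBoxF (TNeg a)).
Definition TBoxP (a : tform) := TNeg (TDiaP (TNeg a)).

Fixpoint bsubst (s : nat -> bform) (a : bform) : bform :=
  match a with
  | BVar p => s p
  | BBot => BBot
  | BTop => BTop
  | BAnd a b => BAnd (bsubst s a) (bsubst s b)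
  | BOr a b => BOr (bsubst s a) (bsubst s b)
  | BImp a b => BImp (bsubst s a) (bsubst s b)
  | BCoimp a b => BCoimp (bsubst s a) (bsubst s b)
  end.

Fixpoint tsubst (s : nat -> tform) (a : tform) : tform :=
  match a with
  | TVar p => s p
  | TBot => TBot
  | TTop => TTop
  | TAnd a b => TAnd (tsubst s a) (tsubst s b)
  | TOr a b => TOr (tsubst s a) (tsubst s b)
  | TNeg a => TNeg (tsubst s a)
  | TBoxF a => TBoxF (tsubst s a)
  | TDiaP a => TDiaP (tsubst s a)
  end.

(** * The logics bi-IPC and S4.t *)

(** Rauszer's Hilbert calculus: intuitionistic axiom schemes, four schemes for
    co-implication, modus ponens, and from [a] infer [~ (T <- a)]. *)
Inductive biIPC : bform -> Prop :=
| biIPC_k a b : biIPC (BImp a (BImp b a))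
| biIPC_s a b c :
    biIPC (BImp (BImp a (BImp b c)) (BImp (BImp a b) (BImp a c)))
| biIPC_and_intro a b : biIPC (BImp a (BImp b (BAnd a b)))
| biIPC_and_elim1 a b : biIPC (BImp (BAnd a b) a)
| biIPC_and_elim2 a b : biIPC (BImp (BAnd a b) b)
| biIPC_or_intro1 a b : biIPC (BImp a (BOr a b))
| biIPC_or_intro2 a b : biIPC (BImp b (BOr a b))
| biIPC_or_elim a b c :
    biIPC (BImp (BImp a c) (BImp (BImp b c) (BImp (BOr a b) c)))
| biIPC_bot a : biIPC (BImp BBot a)
| biIPC_top : biIPC BTop
| biIPC_coimp1 a b : biIPC (BImp a (BOr b (BCoimp a b)))
| biIPC_coimp2 a b : biIPC (BImp (BCoimp a b) (BCoimp BTop (BImp a b)))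
| biIPC_coimp3 a b c :
    biIPC (BImp (BCoimp (BCoimp a b) c) (BCoimp a (BOr b c)))
| biIPC_coimp4 a b : biIPC (BImp (BNeg (BCoimp a b)) (BImp a b))
| biIPC_mp a b : biIPC a -> biIPC (BImp a b) -> biIPC b
| biIPC_dn a : biIPC a -> biIPC (BNeg (BCoimp BTop a)).

(** Boolean evaluation in which variables and modal formulae are atoms. *)
Fixpoint tbeval (v : tform -> bool) (a : tform) : bool :=
  match a with
  | TVar _ | TBoxF _ | TDiaP _ => v a
  | TBot => false
  | TTop => true
  | TAnd a b => tbeval v a && tbeval v b
  | TOr a b => tbeval v a || tbeval v b
  | TNeg a => ~~ tbeval v a
  end.

Definition tautology (a : tform) : Prop := forall v, tbeval v a.

(** The duality schemes [S4t_dual1], [S4t_dual2] are part of the normality of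
    the primitive [TDiaP]: without them [TDiaP a] and [TDiaP (~ ~ a)] would not
    be provably equivalent.  [S4t_conv2] is part of the minimal tense logic; it
    does not follow from [S4t_conv1]. *)
Inductive S4t : tform -> Prop :=
| S4t_taut a : tautology a -> S4t a
| S4t_KF a b : S4t (TImp (TBoxF (TImp a b)) (TImp (TBoxF a) (TBoxF b)))
| S4t_KP a b : S4t (TImp (TBoxP (TImp a b)) (TImp (TBoxP a) (TBoxP b)))
| S4t_dual1 a : S4t (TImp (TDiaP a) (TNeg (TBoxP (TNeg a))))
| S4t_dual2 a : S4t (TImp (TNeg (TBoxP (TNeg a))) (TDiaP a))
| S4t_conv1 a : S4t (TImp a (TBoxF (TDiaP a)))
| S4t_conv2 a : S4t (TImp a (TBoxP (TDiaF a)))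
| S4t_TF a : S4t (TImp (TBoxF a) a)
| S4t_4F a : S4t (TImp (TBoxF a) (TBoxF (TBoxF a)))
| S4t_TP a : S4t (TImp (TBoxP a) a)
| S4t_4P a : S4t (TImp (TBoxP a) (TBoxP (TBoxP a)))
| S4t_mp a b : S4t a -> S4t (TImp a b) -> S4t b
| S4t_necF a : S4t a -> S4t (TBoxF a)
| S4t_necP a : S4t a -> S4t (TBoxP a).

(** * Rules and rule systems *)

(** The rule [G / D] is the pair [(G, D)]. *)
Definition rule (form : choiceType) : Type := ({fset form} * {fset form})%type.

Record rule_system (form : choiceType) (subst : (nat -> form) -> form -> form)
    (S : rule form -> Prop) : Prop := RuleSystem {
  rs_subst : forall (s : nat -> form) (G D : {fset form}),
    S (G, D) -> S (subst s @` G, subst s @` D);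
  rs_refl : forall a : form, S ([fset a], [fset a]);
  rs_weak : forall G D G' D' : {fset form},
    S (G, D) -> S (G `|` G', D `|` D');
  rs_cut : forall (G D : {fset form}) (a : form),
    S (G, a |` D) -> S (a |` G, D) -> S (G, D)
}.

Record bsi_rule_system (L : rule bform -> Prop) : Prop := BsiRuleSystem {
  bsi_rs : rule_system bsubst L;
  bsi_thm : forall a, biIPC a -> L (fset0, [fset a]);
  bsi_mp : forall a b, L ([fset a; BImp a b], [fset b]);
  bsi_dn : forall a, L ([fset a], [fset BNeg (BCoimp BTop a)])
}.

(** In the rule [a / ~ (T <- a)] the arguments of [<-] are ordered according to
    the reading "T but not a".  With the opposite order the conclusion is
    already a theorem, so that rule is in every bsi-rule system as well. *)
Lemma bsi_dn_swapped (L : rule bform -> Prop) : bsi_rule_system L ->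
  forall a, L ([fset a], [fset BNeg (BCoimp a BTop)]).
Proof.
move=> HL a.
have thm : biIPC (BNeg (BCoimp a BTop)).
  have Htop : biIPC (BImp a BTop).
    exact: (biIPC_mp biIPC_top (biIPC_k _ _)).
  apply: (biIPC_mp (biIPC_coimp2 a BTop)).
  apply: (biIPC_mp _ (biIPC_s _ _ _)).
  exact: (biIPC_mp (biIPC_dn Htop) (biIPC_k _ _)).
have := rs_weak (bsi_rs HL) [fset a] fset0 (bsi_thm HL thm).
by rewrite fset0U fsetU0.
Qed.

Record tense_rule_system (M : rule tform -> Prop) : Prop := TenseRuleSystem {
  tense_rs : rule_system tsubst M;
  tense_thm : forall a, S4t a -> M (fset0, [fset a]);
  tense_mp : forall a b, M ([fset a; TImp a b], [fset b]);
  tense_necF : forall a, M ([fset a], [fset TBoxF a]);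
  tense_necP : forall a, M ([fset a], [fset TBoxP a])
}.

Definition S4t_R (r : rule tform) : Prop :=
  forall M, tense_rule_system M -> M r.

Definition oplus (M1 M2 : rule tform -> Prop) (r : rule tform) : Prop :=
  forall M, tense_rule_system M ->
    (forall q, M1 q -> M q) -> (forall q, M2 q -> M q) -> M r.

(** * The translation *)

Fixpoint transl (a : bform) : tform :=
  match a with
  | BVar p => TBoxF (TVar p)
  | BBot => TBot
  | BTop => TTop
  | BAnd a b => TAnd (transl a) (transl b)
  | BOr a b => TOr (transl a) (transl b)
  | BImp a b => TBoxF (TOr (TNeg (transl a)) (transl b))
  | BCoimp a b => TDiaP (TAnd (transl a) (TNeg (transl b)))
  end.

Definition rule_transl (r : rule bform) : rule tform :=
  (transl @` r.1, transl @` r.2).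

Definition tau (L : rule bform -> Prop) : rule tform -> Prop :=
  oplus S4t_R (fun r => exists2 q, L q & r = rule_transl q).

(** * Kripke semantics *)

(** The carrier may be empty. *)
Record kframe : Type := KFrame {
  kcarrier :> Type;
  krel : kcarrier -> kcarrier -> Prop
}.

Definition is_poset (F : kframe) : Prop :=
  Relation_Definitions.order F (@krel F).

Definition upset (F : kframe) (U : F -> Prop) : Prop :=
  forall x y, krel x y -> U x -> U y.

Fixpoint bsat (F : kframe) (V : nat -> F -> Prop) (a : bform) (x : F) : Prop :=
  match a with
  | BVar p => V p x
  | BBot => False
  | BTop => True
  | BAnd a b => bsat V a x /\ bsat V b x
  | BOr a b => bsat V a x \/ bsat V b x
  | BImp a b => forall y, krel x y -> bsat V a y -> bsat V b y
  | BCoimp a b => exists y, [/\ krel y x, bsat V a y & ~ bsat V b y]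
  end.

Fixpoint tsat (F : kframe) (V : nat -> F -> Prop) (a : tform) (x : F) : Prop :=
  match a with
  | TVar p => V p x
  | TBot => False
  | TTop => True
  | TAnd a b => tsat V a x /\ tsat V b x
  | TOr a b => tsat V a x \/ tsat V b x
  | TNeg a => ~ tsat V a x
  | TBoxF a => forall y, krel x y -> tsat V a y
  | TDiaP a => exists2 y, krel y x & tsat V a y
  end.

Definition bvalid (F : kframe) (r : rule bform) : Prop :=
  forall V : nat -> F -> Prop, (forall p, upset (V p)) ->
    (forall a, a \in r.1 -> forall x, bsat V a x) ->
    exists2 b, b \in r.2 & forall x, bsat V b x.

Definition tvalid (F : kframe) (r : rule tform) : Prop :=
  forall V : nat -> F -> Prop,
    (forall a, a \in r.1 -> forall x, tsat V a x) ->
    exists2 b, b \in r.2 & forall x, tsat V b x.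

Definition bsi_kripke_complete (L : rule bform -> Prop) : Prop :=
  exists C : kframe -> Prop, (forall F, C F -> is_poset F) /\
    forall r, L r <-> (forall F, C F -> bvalid F r).

Definition tense_kripke_complete (M : rule tform -> Prop) : Prop :=
  exists C : kframe -> Prop, forall r, M r <-> (forall F, C F -> tvalid F r).

(* Main.v *)
Require Import Defs.
From mathcomp Require Import all_boot finmap.
From mathcomp Require Import boolp.

(** If [F] is a preorder with skeleton [X], then a bsi-rule is valid on [X] iff its
    translation is valid on [F].

    From right to left, completeness of [tau L] for a class of preorders gives
    completeness of [L] for their skeletons, once [T r \in tau L] is known to
    imply [r \in L].  If [r \notin L], a maximal set of formulae separating the
    premises of [r] from its conclusions has a Lindenbaum algebra; on its poset of
    prime theories the Boolean combinations of definable upsets are closed under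
    the tense operations, and the resulting general frame validates [tau L] and
    refutes [T r].

    From left to right, let [r \notin tau L], separated by a maximal set [O], and
    let [Th] be the set of subformulae of [r].  The subsets of [Th] that [O] does
    not exclude are the types, and the transitive filtration of a refuting model
    orders them by the modal formulae they contain, so that a cluster is given by
    its set of true modal formulae.  These formulae are upsets, hence can be read
    as variables of a bsi-rule saying that every point sees only realised
    clusters, that modal formulae have their witnesses, and that some realised
    cluster is missed.  Its translation, with the modal formulae substituted back,
    contradicts [O], so a poset of the class for [L] refutes it.  Replacing each
    point of this poset by the types in its cluster refutes [r] on a preorder with
    the same skeleton. *)

Set Implicit Arguments.
Unset Strict Implicit.
Unset Printing Implicit Defensive.

Local Open Scope fset_scope.

(** * Multiple-conclusion entailments and Lindenbaum's lemma *)

(** Only structural rules, so that rule systems are covered as well as [entailsO], the entailment of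
    one fixed theory, which need not be closed under substitution. *)
Record entailment (form : choiceType) (S : rule form -> Prop) : Prop :=
  Entailment {
  ent_refl : forall a, S ([fset a], [fset a]);
  ent_weak : forall G D G' D' : {fset form},
    S (G, D) -> G `<=` G' -> D `<=` D' -> S (G', D');
  ent_cut : forall (G D : {fset form}) a,
    S (G, a |` D) -> S (a |` G, D) -> S (G, D)
}.

Lemma rule_system_entailment (form : choiceType) subst
  (S : rule form -> Prop) : rule_system subst S -> entailment S.
Proof.
case=> _ refl weak cut; split=> // G D G' D' SGD GG' DD'.
by have := weak _ _ G' D' SGD; rewrite (fsetUidPr _ _ GG') (fsetUidPr _ _ DD').
Qed.

Definition consistent (form : choiceType) (S : rule form -> Prop)
    (P Q : form -> Prop) : Prop :=
  forall G D : {fset form}, (forall a, a \in G -> P a) ->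
    (forall a, a \in D -> Q a) -> ~ S (G, D).

Lemma consistentS (form : choiceType) (S : rule form -> Prop)
    (P P' Q : form -> Prop) :
  (forall a, P' a -> P a) -> consistent S P Q -> consistent S P' Q.
Proof. by move=> sP con G D GP'; apply: con => a /GP'/sP. Qed.

(** Consistency with the complement: the multiple-conclusion analogue of a prime theory. *)
Definition maximal (form : choiceType) (S : rule form -> Prop)
    (O : form -> Prop) : Prop :=
  consistent S O (fun a => ~ O a).

Fixpoint lindenbaum_stage (form : countType) (S : rule form -> Prop)
    (P Q : form -> Prop) (n : nat) : form -> Prop :=
  match n with
  | 0 => P
  | n.+1 => fun b => lindenbaum_stage S P Q n b \/
      choice.unpickle n = Some b /\
      consistent S (fun c => lindenbaum_stage S P Q n c \/ c = b) Q
  end.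

(** A formula is missing from the union [O] of the stages only because adding it to [O] yields a
    rule with conclusions in [Q]. Cuts against such rules make [O] consistent with its
    complement. *)
Lemma lindenbaum (form : countType) (S : rule form -> Prop)
    (P Q : form -> Prop) : entailment S -> consistent S P Q ->
  exists O : form -> Prop,
    [/\ forall a, P a -> O a, forall a, Q a -> ~ O a & maximal S O].
Proof.
move=> entS con; pose st := lindenbaum_stage S P Q.
have stM m n : m <= n -> forall a, st m a -> st n a.
  by elim: n => [|n IH]; rewrite leq_eqVlt => /predU1P[-> //|] // /IH Hm a /Hm;
    left.
have stcon n : consistent S (st n) Q.
  elim: n => // n IH.
  have [[b [nb conb]]|nob] := EM (exists b, choice.unpickle n = Some b /\
      consistent S (fun c => st n c \/ c = b) Q).
    apply: consistentS conb => c [|[nc _]]; first by left.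
    by right; move: nc; rewrite nb => -[].
  by apply: consistentS IH => c [//|bc]; case: nob; exists c.
pose O a := exists n, st n a.
have finO (s : seq form) : (forall a, a \in s -> O a) ->
    exists n, forall a, a \in s -> st n a.
  elim: s => [|a s IH] sO; first by exists 0.
  have [|n Hn] := IH; first by move=> b bs; apply: sO; rewrite inE bs orbT.
  have [|m Hm] := sO a; first by rewrite inE eqxx.
  exists (maxn m n) => b; rewrite inE => /predU1P[->|/Hn].
    exact: stM (leq_maxl _ _) _ Hm.
  exact: stM (leq_maxr _ _) _.
have conO : consistent S O Q.
  by move=> G D /finO[n Gn]; apply: (stcon n).
have inc d : ~ O d -> exists G D : {fset form},
    [/\ forall a, a \in G -> O a \/ a = d, forall a, a \in D -> Q a & S (G, D)].
  move=> nOd; apply: contrapT => H; apply: nOd.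
  exists (choice.pickle d).+1; right; rewrite choice.pickleK; split=> // G D GP DQ SGD.
  apply: H; exists G, D; split=> // a /GP[sa|]; last by right.
  by left; exists (choice.pickle d).
exists O; split=> [a Pa|a Qa Oa|].
- by exists 0.
- by apply: (conO [fset a] [fset a]) (ent_refl entS a) => b; rewrite inE => /eqP->.
(* Conclusions in [Q] are allowed besides a list [s] of formulae outside [O]; each induction step
   cuts away the head of [s] using [inc]. *)
- suff key (s : seq form) (E G : {fset form}) : (forall d, d \in s -> ~ O d) ->
      (forall e, e \in E -> e \in s \/ Q e) -> (forall a, a \in G -> O a) ->
      ~ S (G, E).
    by move=> G D GO DO; apply: (key (enum_fset D)) => // e; left.
  elim: s E G => [|d s IH] E G sO EQ GO SGE.
    by apply: conO SGE => // e /EQ[].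
  have [|G1 [D1 [G1O D1Q S1]]] := inc d; first by apply: sO; rewrite inE eqxx.
  apply: (IH ((E `\ d) `|` D1) (G `|` (G1 `\ d))).
  + by move=> e es; apply: sO; rewrite inE es orbT.
  + move=> e; rewrite !inE => /orP[/andP[ed /EQ]|/D1Q]; last by right.
    by rewrite inE (negPf ed).
  + move=> e; rewrite !inE => /orP[/GO //|/andP[/eqP ed /G1O]].
    by case.
  + apply: (ent_cut entS (a := d)).
      apply: ent_weak SGE _ _ => //; first exact: fsubsetUl.
      by apply/fsubsetP=> e eE; rewrite !inE eE andbT orbA orbN.
    apply: ent_weak S1 _ _ => //; last exact: fsubsetUr.
    by apply/fsubsetP=> e eE; rewrite !inE eE andbT orbCA orbN orbT.
Qed.

Lemma maximal_rule (form : choiceType) (S : rule form -> Prop) O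
    (G D : {fset form}) : maximal S O -> S (G, D) ->
  (forall a, a \in G -> O a) -> exists2 a, a \in D & O a.
Proof.
move=> maxO SGD GO; apply: contrapT => nD; apply: maxO SGD => // a aD Oa.
by apply: nD; exists a.
Qed.

(** * Skeletons *)

(** [f] exhibits the poset [X] as the quotient of [F] by its clusters. *)
Definition skeleton (F X : kframe) (f : F -> X) : Prop :=
  (forall y y', krel y y' <-> krel (f y) (f y')) /\ (forall x, exists y, f y = x).

Section Skeleton.
Context (F X : kframe) (f : F -> X) (skf : skeleton f).

Lemma skeleton_sat (V : nat -> F -> Prop) (U : nat -> X -> Prop) :
  (forall p y, (forall z, krel y z -> V p z) <-> U p (f y)) ->
  forall a y, tsat V (transl a) y <-> bsat U a (f y).
Proof.
case: skf => relf surf VU; elim=> //=.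
- by move=> a IHa b IHb y; rewrite IHa IHb.
- by move=> a IHa b IHb y; rewrite IHa IHb.
- move=> a IHa b IHb y; split=> [H x yx Ua|H z yz].
    have [z fz] := surf x; rewrite -fz in yx Ua *.
    by have /relf/H[/IHa //|/IHb] := yx.
  have [Va|] := EM (tsat V (transl a) z); last by left.
  by right; apply/IHb/H; [apply/relf|apply/IHa].
- move=> a IHa b IHb y; split=> [[z zy [/IHa Ua nb]]|[x []]].
    by exists (f z); split=> //; [apply/relf|move=> /IHb].
  have [z <-] := surf x => /relf zy /IHa Va nb.
  by exists z => //; split=> // /IHb.
Qed.

(** Valuations travel both ways: [V] on [F] descends to the upsets given by the boxes of [V p], and
    an upset valuation of [X] is pulled back along [f], where it agrees with its own box. *)
Lemma skeleton_valid q : is_poset X -> bvalid X q <-> tvalid F (rule_transl q).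
Proof.
case=> Xr Xt _; have [relf surf] := skf; split=> valid V.
  move=> GV; pose U p x := forall z, krel x (f z) -> V p z.
  have sat := skeleton_sat (V := V) (U := U).
  have {}sat a y : tsat V (transl a) y <-> bsat U a (f y).
    by apply: sat => p {}y; split=> H z; move=> /relf; apply: H.
  have [p x x' xx' Ux z x'z|a aG x|b bD Hb] := valid U.
  + by apply: Ux; apply: Xt x'z.
  + by have [y <-] := surf x; apply/sat/GV; exact: in_imfset.
  + by exists (transl b) => [|y]; [exact: in_imfset|apply/sat].
move=> Vup GV; pose V' p y := V p (f y).
have sat a y : tsat V' (transl a) y <-> bsat V a (f y).
  apply: skeleton_sat => p {}y; split=> [H|Vy z yz].
    by apply: H; apply/relf; apply: Xr.
  by apply: Vup Vy; apply/relf.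
have [_ /imfsetP[a /= aG ->] y|_ /imfsetP[b /= bD ->] Hb] := valid V'.
  by apply/sat/GV.
by exists b => // x; have [y <-] := surf x; apply/sat.
Qed.

End Skeleton.

(* Points of the quotient are represented by their principal upsets. *)
Lemma skeleton_exists (F : kframe) :
  (forall x : F, krel x x) ->
  (forall x y z : F, krel x y -> krel y z -> krel x z) ->
  exists (X : kframe) (f : F -> X), is_poset X /\ skeleton f.
Proof.
move=> Fr Ft; pose car := {c : F -> Prop | exists x, c = krel x}.
pose rel (c d : car) := forall z, sval d z -> sval c z.
pose f x : car := exist _ (krel x) (ex_intro _ x erefl).
exists (KFrame rel), f; split; [split|split].
- by move=> c z.
- by move=> c d e cd de z /de/cd.
- move=> [c Hc] [d Hd] cd dc; apply: eq_exist; apply/predeqP => z.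
  by split; [apply: dc|apply: cd].
- move=> x y; split=> [xy z yz|]; first exact: Ft yz.
  by apply; apply: Fr.
- by move=> [c [x cx]]; exists x; apply: eq_exist.
Qed.

(** * Soundness over general frames *)

(** [B] is the family of admissible sets of a general frame; all sets give Kripke validity. *)
Definition gvalid (F : kframe) (B : (F -> Prop) -> Prop) (r : rule tform) :
    Prop :=
  forall V : nat -> F -> Prop, (forall p, B (V p)) ->
    (forall a, a \in r.1 -> forall x, tsat V a x) ->
    exists2 b, b \in r.2 & forall x, tsat V b x.

Lemma gvalidT (F : kframe) r : gvalid (fun _ : F -> Prop => True) r <-> tvalid F r.
Proof. by split=> H V; [apply: H|move=> _; apply: H]. Qed.

Lemma tsat_subst (F : kframe) (V : nat -> F -> Prop) s a x :
  tsat V (tsubst s a) x <-> tsat (fun p => tsat V (s p)) a x.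
Proof.
elim: a x => //=.
- by move=> a IHa b IHb x; rewrite IHa IHb.
- by move=> a IHa b IHb x; rewrite IHa IHb.
- by move=> a IHa x; rewrite IHa.
- by move=> a IHa x; split=> H y /H/IHa.
- by move=> a IHa x; split=> -[y yx /IHa]; exists y.
Qed.

Lemma tsat_beval (F : kframe) (V : nat -> F -> Prop) a x :
  tsat V a x <-> tbeval (fun b => `[<tsat V b x>]) a.
Proof.
elim: a => //=.
- by move=> n; split=> /asboolP.
- by move=> a IHa b IHb; rewrite IHa IHb; split=> /andP.
- by move=> a IHa b IHb; rewrite IHa IHb; split=> /orP.
- by move=> a IHa; rewrite IHa; split=> /negP.
- by move=> a _; split=> /asboolP.
- by move=> a _; split=> /asboolP.
Qed.

Lemma tsat_neg (F : kframe) (V : nat -> F -> Prop) a x :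
  tsat V (TNeg a) x <-> ~ tsat V a x.
Proof. by []. Qed.

Lemma tsat_imp (F : kframe) (V : nat -> F -> Prop) a b x :
  tsat V (TImp a b) x <-> (tsat V a x -> tsat V b x).
Proof.
split=> /= [[//|//]|H].
by have [/H|] := EM (tsat V a x); [right|left].
Qed.

Lemma tsat_boxP (F : kframe) (V : nat -> F -> Prop) a x :
  tsat V (TBoxP a) x <-> (forall y, krel y x -> tsat V a y).
Proof.
split=> /= [H y yx|H [y /H //]].
by apply: contrapT => na; apply: H; exists y.
Qed.

Lemma tsat_diaF (F : kframe) (V : nat -> F -> Prop) a x :
  tsat V (TDiaF a) x <-> (exists2 y, krel x y & tsat V a y).
Proof.
split=> /= [H|[y xy ya] /(_ y xy)//].
by apply: contrapT => na; apply: H => y xy ya; apply: na; exists y.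
Qed.

Section Soundness.
Context (F : kframe) (B : (F -> Prop) -> Prop).
Context (Fr : forall x : F, krel x x).
Context (Ft : forall x y z : F, krel x y -> krel y z -> krel x z).
Context (Btsat : forall V a, (forall p, B (V p)) -> B (tsat V a)).

Lemma S4t_sound (V : nat -> F -> Prop) a : S4t a -> forall x, tsat V a x.
Proof.
elim=> {a}.
- by move=> a taut x; apply/tsat_beval.
- move=> a b x; apply/tsat_imp => ab; apply/tsat_imp => Ha y xy.
  by move/tsat_imp: (ab y xy); apply; apply: Ha.
- move=> a b x; apply/tsat_imp => /tsat_boxP ab; apply/tsat_imp => /tsat_boxP Ha.
  by apply/tsat_boxP => y yx; move/tsat_imp: (ab y yx); apply; apply: Ha.
- move=> a x; apply/tsat_imp => -[y yx ya] /= /(_ _)[].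
  by exists y => // /(_ ya).
- move=> a x; apply/tsat_imp => /tsat_neg H; apply: contrapT => na; apply: H.
  by apply/tsat_boxP => y yx ya; apply: na; exists y.
- by move=> a x; apply/tsat_imp => Ha y xy; exists x.
- move=> a x; apply/tsat_imp => Ha; apply/tsat_boxP => y yx.
  by apply/tsat_diaF; exists x.
- by move=> a x; apply/tsat_imp; apply.
- by move=> a x; apply/tsat_imp => H y xy z yz; apply: H; apply: Ft yz.
- by move=> a x; apply/tsat_imp => /tsat_boxP; apply.
- move=> a x; apply/tsat_imp => /tsat_boxP H; apply/tsat_boxP => y yx.
  by apply/tsat_boxP => z zy; apply: H; apply: Ft yx.
- by move=> a b _ Ha _ Hab x; move/tsat_imp: (Hab x); apply.
- by move=> a _ Ha x y _; apply: Ha.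
- by move=> a _ Ha x; apply/tsat_boxP.
Qed.

Lemma gvalid_tense : tense_rule_system (gvalid B).
Proof.
split.
- split.
  + move=> s G D valid V VB GV.
    have [p|a aG x|b bD Hb] := valid (fun p => tsat V (s p)).
    * exact: Btsat.
    * by apply/tsat_subst/GV; exact: in_imfset.
    * by exists (tsubst s b) => [|x]; [exact: in_imfset|apply/tsat_subst].
  + by move=> a V _ H; exists a => [|x]; [|apply: H]; rewrite inE.
  + move=> G D G' D' valid V VB GV.
    have [a aG|b bD Hb] := valid V VB; first by apply: GV; rewrite inE aG.
    by exists b => //; rewrite inE bD.
  + move=> G D a v1 v2 V VB GV; have [b] := v1 V VB GV.
    rewrite !inE => /orP[/eqP-> Ha|]; last by exists b.
    by apply: (v2 V VB) => c; rewrite !inE => /orP[/eqP-> //|]; apply: GV.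
- by move=> a Ha V _ _; exists a; [rewrite inE|exact: S4t_sound].
- move=> a b V _ H; exists b; rewrite ?inE // => x.
  have /tsat_imp : tsat V (TImp a b) x by apply: H; rewrite !inE eqxx orbT.
  apply.
  by apply: H; rewrite !inE eqxx.
- by move=> a V _ H; exists (TBoxF a); rewrite ?inE // => x y _; apply: H; rewrite inE.
- move=> a V _ H; exists (TBoxP a); rewrite ?inE // => x.
  by apply/tsat_boxP => y _; apply: H; rewrite inE.
Qed.

End Soundness.
(** * Conservativity of the translation *)

Record bi_theory (O : bform -> Prop) : Prop := BiTheory {
  bt_thm : forall a, biIPC a -> O a;
  bt_mp : forall a b, O (BImp a b) -> O a -> O b;
  bt_dn : forall a, O a -> O (BNeg (BCoimp BTop a))
}.

Lemma maximal_bi_theory L O : bsi_rule_system L -> maximal L O -> bi_theory O.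
Proof.
move=> [_ thm mp dn] maxO; split.
- move=> a /thm La; have [c|b /[!inE]/eqP-> //] := maximal_rule maxO La.
  by rewrite inE.
- move=> a b Oab Oa; have [|c /[!inE]/eqP-> //] := maximal_rule maxO (mp a b).
  by move=> c /[!inE]/orP[]/eqP->.
- move=> a Oa; have [|c /[!inE]/eqP-> //] := maximal_rule maxO (dn a).
  by move=> c /[!inE]/eqP->.
Qed.

(** * The Lindenbaum algebra of a bi-intuitionistic theory *)

Section PrimeTheories.
Context (O : bform -> Prop) (OT : bi_theory O).

Local Notation "a ≤ b" := (O (BImp a b)) (at level 70).

Lemma leO_weak a b : O b -> a ≤ b.
Proof. by move/(bt_mp OT (bt_thm OT (biIPC_k b a))). Qed.

Lemma leO_S a b c : a ≤ BImp b c -> a ≤ b -> a ≤ c.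
Proof.
by move=> abc; apply: bt_mp => //; apply: (bt_mp OT) abc; apply/(bt_thm OT)/biIPC_s.
Qed.

Lemma leO_refl a : a ≤ a.
Proof. exact: (leO_S (bt_thm OT (biIPC_k a (BImp a a))) (bt_thm OT (biIPC_k a a))). Qed.

Lemma leO_trans b a c : a ≤ b -> b ≤ c -> a ≤ c.
Proof. by move=> ab bc; apply: leO_S ab; apply: leO_weak. Qed.

Lemma leO_top a : BTop ≤ a <-> O a.
Proof. by split=> [|/leO_weak//]; move/(bt_mp OT); apply; apply/(bt_thm OT)/biIPC_top. Qed.

Lemma leO_andl a b : BAnd a b ≤ a. Proof. exact/(bt_thm OT)/biIPC_and_elim1. Qed.
Lemma leO_andr a b : BAnd a b ≤ b. Proof. exact/(bt_thm OT)/biIPC_and_elim2. Qed.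
Lemma leO_orl a b : a ≤ BOr a b. Proof. exact/(bt_thm OT)/biIPC_or_intro1. Qed.
Lemma leO_orr a b : b ≤ BOr a b. Proof. exact/(bt_thm OT)/biIPC_or_intro2. Qed.

Lemma leO_and c a b : c ≤ a -> c ≤ b -> c ≤ BAnd a b.
Proof.
move=> ca; apply: leO_S; apply: leO_trans ca _.
exact/(bt_thm OT)/biIPC_and_intro.
Qed.

Lemma leO_or a b c : a ≤ c -> b ≤ c -> BOr a b ≤ c.
Proof.
move=> ac; apply: (bt_mp OT); apply: (bt_mp OT) ac.
exact/(bt_thm OT)/biIPC_or_elim.
Qed.

Lemma leO_imp a b c : BAnd a b ≤ c <-> a ≤ BImp b c.
Proof.
split=> [abc|abc]; last first.
  by apply: leO_S (leO_andr a b); apply: leO_trans abc; apply: leO_andl.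
apply: leO_trans (bt_thm OT (biIPC_and_intro a b)) _.
apply: (bt_mp OT) (leO_weak b abc); exact/(bt_thm OT)/biIPC_s.
Qed.

(** Residuation for co-implication. From right to left, [biIPC_coimp4] leaves
    [BCoimp (BCoimp a b) c] to be refuted; it lies below [BCoimp BTop (BImp a (BOr b c))], which
    [bt_dn] refutes. *)
Lemma leO_coimp a b c : BCoimp a b ≤ c <-> a ≤ BOr b c.
Proof.
split=> [abc|abc].
  apply: leO_trans (bt_thm OT (biIPC_coimp1 a b)) _.
  by apply: leO_or; [apply: leO_orl|apply: leO_trans abc _; apply: leO_orr].
apply: (bt_mp OT) (bt_thm OT (biIPC_coimp4 _ _)) _.
apply: leO_trans (bt_thm OT (biIPC_coimp3 _ _ _)) _.
apply: leO_trans (bt_thm OT (biIPC_coimp2 _ _)) _.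
exact: bt_dn.
Qed.

(* The meet of [G] lies below the join of [D] in the Lindenbaum algebra of [O];
   quantifying over bounds makes this insensitive to the order in which a finite
   set is enumerated. *)
Definition entailsO (r : rule bform) : Prop :=
  forall c d, (forall a, a \in r.1 -> c ≤ a) -> (forall b, b \in r.2 -> b ≤ d) ->
  c ≤ d.

Lemma entailsO_entailment : entailment entailsO.
Proof.
split=> [a c d ca ad|G D G' D' ent GG' DD' c d Gc Dd|G D a ent1 ent2 c d Gc Dd].
- by apply: (leO_trans (b := a)); [apply: ca|apply: ad]; rewrite inE.
- by apply: ent => a; [move/(fsubsetP GG')/Gc|move/(fsubsetP DD')/Dd].
- have c_da : c ≤ BOr d a.
    apply: ent1 => // b; rewrite !inE => /orP[/eqP->|/Dd bd]; first exact: leO_orr.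
    exact: leO_trans bd (leO_orl _ _).
  have ca_d : BAnd c a ≤ d.
    apply: ent2 => // b; rewrite !inE => /orP[/eqP->|/Gc cb]; first exact: leO_andr.
    exact: leO_trans (leO_andl _ _) cb.
  (* Both [d] and [a] lie below [BImp c d], hence so does [c], and contraction gives the claim. *)
  apply: (leO_S (b := c)) (leO_refl _); apply: leO_trans c_da _; apply: leO_or.
    by apply/leO_imp; apply: leO_andl.
  apply/leO_imp; apply: leO_trans ca_d.
  by apply: leO_and; [apply: leO_andr|apply: leO_andl].
Qed.

(** * The poset of prime theories *)

Definition prime_frame : kframe :=
  @KFrame {x : bform -> Prop | maximal entailsO x}
    (fun x y => forall a, sval x a -> sval y a).

Implicit Types x y : prime_frame.

Lemma prime_extend (P Q : bform -> Prop) : consistent entailsO P Q ->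
  exists x, (forall a, P a -> sval x a) /\ (forall a, Q a -> ~ sval x a).
Proof.
by case/(lindenbaum entailsO_entailment) => x [? ? maxx]; exists (exist _ x maxx).
Qed.

Lemma prime_le x a b : a ≤ b -> sval x a -> sval x b.
Proof.
case: x => x maxx /= ab xa.
have [||c /[!inE]/eqP-> //] := maximal_rule (G := [fset a]) (D := [fset b]) maxx.
  move=> c d ca bd; apply: (leO_trans (b := a)); first by apply: ca; rewrite inE.
  by apply: leO_trans ab _; apply: bd; rewrite inE.
by move=> c /[!inE]/eqP->.
Qed.

Lemma prime_and x a b : sval x (BAnd a b) <-> sval x a /\ sval x b.
Proof.
split=> [xab|]; first by split; apply: prime_le xab; [apply: leO_andl|apply: leO_andr].
case: x => x maxx /= [xa xb].
have [||c /[!inE]/eqP-> //] :=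
    maximal_rule (G := [fset a; b]) (D := [fset BAnd a b]) maxx.
  move=> c d ca bd; apply: (leO_trans (b := BAnd a b)).
    by apply: leO_and; apply: ca; rewrite !inE eqxx ?orbT.
  by apply: bd; rewrite inE.
by move=> c /[!inE]/orP[]/eqP->.
Qed.

Lemma prime_or x a b : sval x (BOr a b) <-> sval x a \/ sval x b.
Proof.
split=> [|[]]; last 2 first.
- by apply: prime_le; apply: leO_orl.
- by apply: prime_le; apply: leO_orr.
case: x => x maxx /= xab.
have [||c /[!inE]/orP[]/eqP->] :=
    maximal_rule (G := [fset BOr a b]) (D := [fset a; b]) maxx.
- move=> c d ca bd; apply: (leO_trans (b := BOr a b)).
    by apply: ca; rewrite inE.
  by apply: leO_or; apply: bd; rewrite !inE eqxx ?orbT.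
- by move=> c /[!inE]/eqP->.
- by left.
- by right.
Qed.

Lemma prime_bot x : ~ sval x BBot.
Proof.
case: x => x maxx /= x0.
have [||c] := maximal_rule (G := [fset BBot]) (D := fset0) maxx; rewrite ?inE //.
- move=> c d ca _; apply: (leO_trans (b := BBot)); first by apply: ca; rewrite inE.
  exact/(bt_thm OT)/biIPC_bot.
- by move=> c /[!inE]/eqP->.
Qed.

Lemma prime_top x : sval x BTop.
Proof.
case: x => x maxx /=.
have [||c /[!inE]/eqP-> //] := maximal_rule (G := fset0) (D := [fset BTop]) maxx.
- move=> c d _ bd; apply: (leO_trans (b := BTop)); last by apply: bd; rewrite inE.
  exact/leO_weak/(bt_thm OT)/biIPC_top.
- by move=> c; rewrite inE.
Qed.

Lemma prime_theorem a : O a <-> forall x, sval x a.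
Proof.
split=> [Oa x|H].
  by apply: prime_le (prime_top x); apply: leO_weak.
apply: contrapT => nOa; have [|x [_ /(_ a erefl)]] :=
    @prime_extend (fun=> False) (fun b => b = a); last by apply; apply: H.
move=> G D G0 Da ent; apply/nOa/leO_top; apply: ent => b; first by move/G0.
by move/Da->; apply: leO_refl.
Qed.

(** For the converse, a prime theory containing [x] and [a] but not [b] is needed. An inconsistency
    uses finitely many members of [x], which are met into one [e]; residuation then puts [BImp a b]
    in [x]. *)
Lemma prime_imp x a b :
  sval x (BImp a b) <-> forall y, krel x y -> sval y a -> sval y b.
Proof.
split=> [xab y xy ya|H].
  apply: (@prime_le y (BAnd (BImp a b) a)); first exact/leO_imp/leO_refl.
  by apply/prime_and; split=> //; apply: xy.
apply: contrapT => nxab.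
have [|y [Py Qy]] :=
    @prime_extend (fun c => sval x c \/ c = a) (fun c => c = b); last first.
  apply: (Qy b erefl); apply: H; last by apply: Py; right.
  by move=> c xc; apply: Py; left.
move=> G D GP DQ ent.
have [e [xe eG]] : exists e, sval x e /\ forall g, g \in enum_fset G -> BAnd e a ≤ g.
  elim: (enum_fset G) (GP : forall g, g \in enum_fset G -> _) => [|g s IH] sP.
    by exists BTop; split=> //; apply: prime_top.
  have [c cs|e [xe es]] := IH; first by apply: sP; rewrite inE cs orbT.
  have [|xg|->] := sP g; first by rewrite inE eqxx.
    exists (BAnd e g); split; first exact/prime_and.
    move=> c; rewrite inE => /predU1P[->|/es].
      exact: leO_trans (leO_andl _ _) (leO_andr _ _).
    apply: leO_trans; apply: leO_and (leO_andr _ _).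
    exact: leO_trans (leO_andl _ _) (leO_andl _ _).
  by exists e; split=> // c; rewrite inE => /predU1P[->|/es //]; apply: leO_andr.
apply: nxab; apply: prime_le xe; apply/leO_imp; apply: ent => // c /DQ->.
exact: leO_refl.
Qed.

(** Dual to [prime_imp]: avoiding everything outside [x] forces the new theory below [x], and
    primality of [x] joins the avoided formulae into one [e] outside [x]. *)
Lemma prime_coimp x a b :
  sval x (BCoimp a b) <-> exists y, [/\ krel y x, sval y a & ~ sval y b].
Proof.
split=> [xab|[y [yx ya nyb]]]; last first.
  have /prime_or[//|] : sval y (BOr b (BCoimp a b)).
    by apply: prime_le ya; apply/leO_coimp/leO_refl.
  exact: yx.
have [|y [Py Qy]] :=
    @prime_extend (fun c => c = a) (fun c => ~ sval x c \/ c = b); last first.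
  exists y; split; [|by apply: Py|by apply: Qy; right].
  by move=> c yc; apply: contrapT => nxc; apply: (Qy c) => //; left.
move=> G D GP DQ ent.
have [e [nxe eD]] : exists e, ~ sval x e /\ forall g, g \in enum_fset D -> g ≤ BOr b e.
  elim: (enum_fset D) (DQ : forall g, g \in enum_fset D -> _) => [|g s IH] sP.
    by exists BBot; split=> //; apply: prime_bot.
  have [c cs|e [nxe es]] := IH; first by apply: sP; rewrite inE cs orbT.
  have [|nxg|->] := sP g; first by rewrite inE eqxx.
    exists (BOr e g); split; first by move/prime_or => [].
    move=> c; rewrite inE => /predU1P[->|/es ce].
      exact: leO_trans (leO_orr _ _) (leO_orr _ _).
    apply: leO_trans ce _; apply: leO_or (leO_orl _ _) _.
    exact: leO_trans (leO_orl _ _) (leO_orr _ _).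
  by exists e; split=> // c; rewrite inE => /predU1P[->|/es //]; apply: leO_orl.
apply: nxe; apply: prime_le xab; apply/leO_coimp; apply: ent => // c /GP->.
exact: leO_refl.
Qed.

(* Every Boolean combination of sets [{x | a \in x}] is a finite intersection of
   sets [{x | a \in x -> b \in x}]. *)
Definition boolean_set (U : prime_frame -> Prop) : Prop :=
  exists l : seq (bform * bform),
    forall x, U x <-> (forall ab, ab \in l -> sval x ab.1 -> sval x ab.2).

Lemma boolean_set_iff U U' : (forall x, U x <-> U' x) ->
  boolean_set U -> boolean_set U'.
Proof. by move=> UU' [l Ul]; exists l => x; rewrite -UU'. Qed.

Lemma boolean_set_clause a b : boolean_set (fun x => sval x a -> sval x b).
Proof.
exists [:: (a, b)] => x; split=> [H ab /[!inE]/eqP-> //|].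
by move=> /(_ (a, b)); apply; rewrite inE.
Qed.

Lemma boolean_set_prime a : boolean_set (fun x => sval x a).
Proof.
apply: boolean_set_iff (boolean_set_clause BTop a) => x.
by split=> [|//]; apply; apply: prime_top.
Qed.

Lemma boolean_set_and U U' : boolean_set U -> boolean_set U' ->
  boolean_set (fun x => U x /\ U' x).
Proof.
move=> [l Ul] [l' Ul']; exists (l ++ l') => x; rewrite Ul Ul'; split.
  by move=> [H H'] ab; rewrite mem_cat => /orP[/H|/H'].
by move=> H; split=> ab abl; apply: H; rewrite mem_cat abl ?orbT.
Qed.

(** A union of two clauses is again a clause: meet the antecedents and join the consequents. *)
Lemma boolean_set_or U U' : boolean_set U -> boolean_set U' ->
  boolean_set (fun x => U x \/ U' x).
Proof.
move=> [l Ul] [l' Ul'].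
exists [seq (BAnd p.1 q.1, BOr p.2 q.2) | p <- l, q <- l'] => x; split.
  move=> UU' _ /allpairsP[[p q] [/= pl ql' ->]] /= /prime_and[xp xq].
  by apply/prime_or; case: UU' => [/Ul H|/Ul' H]; [left|right]; apply: H.
move=> H; have [Ux|nUx] := EM (U x); [by left|right; apply/Ul' => q ql' xq].
apply: contrapT => nxq; apply/nUx/Ul => p pl xp.
have /prime_or[//|//] : sval x (BOr p.2 q.2).
apply: (H (BAnd p.1 q.1, BOr p.2 q.2)); last exact/prime_and.
exact: (allpairs_f (fun p q => (BAnd p.1 q.1, BOr p.2 q.2)) pl ql').
Qed.

Lemma boolean_set_not U : boolean_set U -> boolean_set (fun x => ~ U x).
Proof.
case=> l; elim: l U => [|[a b] l IH] U Ul.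
  apply: boolean_set_iff (boolean_set_prime BBot) => x.
  by rewrite Ul; split=> [/prime_bot //|[]].
apply: boolean_set_iff (boolean_set_or (boolean_set_and (boolean_set_prime a)
  (boolean_set_clause b BBot)) (IH _ (fun=> iff_refl _))) => x.
rewrite Ul; split.
  move=> [[xa xb] /(_ (a, b))|H1 H2].
    by rewrite inE eqxx => /(_ isT xa)/xb/prime_bot.
  by apply: H1 => ab abl; apply: H2; rewrite inE abl orbT.
move=> H; apply: contrapT => /not_orP[H1 H2]; apply: H => ab; rewrite inE.
case/predU1P=> [->|] /=; last by move: ab; apply: contrapT.
by move=> xa; apply: contrapT => nxb; apply: H1; split.
Qed.

(** Boxes distribute over clauses, and the box of a clause is an implication. A single formula
    therefore defines the box, and it can serve as a value of a substitution. *)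
Lemma boolean_set_box U : boolean_set U ->
  exists e, forall x, (forall y, krel x y -> U y) <-> sval x e.
Proof.
case=> l Ul; exists (foldr BAnd BTop [seq BImp ab.1 ab.2 | ab <- l]) => x.
have -> : (forall y, krel x y -> U y) <->
    (forall ab, ab \in l -> sval x (BImp ab.1 ab.2)).
  split=> [H ab abl|H y xy].
    by apply/prime_imp => y /H/Ul; apply.
  by apply/Ul => ab /H/prime_imp; apply.
elim: {Ul}l => [|ab l IH] /=; first by split=> // _; apply: prime_top.
rewrite prime_and -IH; split=> [H|[H1 H2] cd].
  by split=> [|cd cdl]; apply: H; rewrite inE ?eqxx ?cdl ?orbT.
by rewrite inE => /predU1P[->|/H2].
Qed.

(** Writing the complement as an intersection of clauses makes [U] a union of differences, and the
    diamond of a difference is a co-implication. *)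
Lemma boolean_set_dia U : boolean_set U ->
  exists e, forall x, (exists2 y, krel y x & U y) <-> sval x e.
Proof.
case/boolean_set_not => l Ul.
exists (foldr BOr BBot [seq BCoimp ab.1 ab.2 | ab <- l]) => x.
have -> : (exists2 y, krel y x & U y) <->
    (exists2 ab, ab \in l & sval x (BCoimp ab.1 ab.2)).
  split=> [[y yx Uy]|[ab abl /prime_coimp[y [yx ya yb]]]].
    apply: contrapT => nab; have /Ul : forall ab, ab \in l -> sval y ab.1 -> sval y ab.2.
      move=> ab abl ya; apply: contrapT => yb; apply: nab; exists ab => //.
      by apply/prime_coimp; exists y.
    exact.
  by exists y => //; apply: contrapT => /Ul/(_ ab abl ya).
elim: {Ul}l => [|ab l IH] /=; first by split=> [[]|/prime_bot].
rewrite prime_or -IH; split=> [[cd]|].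
  by rewrite inE => /predU1P[->|]; [left|right; exists cd].
by case=> [xab|[cd cdl xcd]]; [exists ab|exists cd]; rewrite // inE ?eqxx ?cdl ?orbT.
Qed.

Lemma boolean_set_tsat (V : nat -> prime_frame -> Prop) a :
  (forall p, boolean_set (V p)) -> boolean_set (tsat V a).
Proof.
move=> BV; elim: a => /=.
- exact: BV.
- apply: boolean_set_iff (boolean_set_prime BBot) => x.
  by split=> [/prime_bot|].
- apply: boolean_set_iff (boolean_set_prime BTop) => x.
  by split=> // _; apply: prime_top.
- by move=> a IHa b IHb; apply: boolean_set_and.
- by move=> a IHa b IHb; apply: boolean_set_or.
- by move=> a IHa; apply: boolean_set_not.
- move=> a /boolean_set_box[e He].
  by apply: boolean_set_iff (boolean_set_prime e) => x; rewrite He.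
- move=> a /boolean_set_dia[e He].
  by apply: boolean_set_iff (boolean_set_prime e) => x; rewrite He.
Qed.

Lemma prime_bsat (s : nat -> bform) a x :
  bsat (fun p (y : prime_frame) => sval y (s p)) a x <-> sval x (bsubst s a).
Proof.
elim: a x => //=.
- by move=> x; split=> // /prime_bot.
- by move=> x; split=> // _; apply: prime_top.
- by move=> a IHa b IHb x; rewrite IHa IHb prime_and.
- by move=> a IHa b IHb x; rewrite IHa IHb prime_or.
- by move=> a IHa b IHb x; rewrite prime_imp; split=> H y /H; rewrite IHa IHb.
- move=> a IHa b IHb x; rewrite prime_coimp.
  by split=> -[y []]; exists y; split; rewrite -?IHa -?IHb // ?IHa ?IHb.
Qed.

(** The frame of prime theories is its own skeleton under the identity map. *)
Lemma prime_tsat (V : nat -> prime_frame -> Prop) s :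
  (forall p x, (forall y, krel x y -> V p y) <-> sval x (s p)) ->
  forall a x, tsat V (transl a) x <-> sval x (bsubst s a).
Proof.
move=> Vs a x; rewrite -prime_bsat.
have skid : skeleton (fun x : prime_frame => x) by split=> // y; exists y.
by apply: (skeleton_sat skid (U := fun p y => sval y (s p))) => p y; apply: Vs.
Qed.

End PrimeTheories.

(** * The tense companion [tau L] *)

Lemma tau_tense L : tense_rule_system (tau L).
Proof.
split.
- split.
  + by move=> s G D H M HM S4M TM; apply: (rs_subst (tense_rs HM)); apply: H.
  + by move=> a M HM S4M TM; apply: (rs_refl (tense_rs HM)).
  + by move=> G D G' D' H M HM S4M TM; apply: (rs_weak (tense_rs HM)); apply: H.
  + move=> G D a H1 H2 M HM S4M TM.
    by apply: (rs_cut (tense_rs HM)); [apply: H1|apply: H2].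
- by move=> a S4a M HM _ _; apply: tense_thm.
- by move=> a b M HM _ _; apply: tense_mp.
- by move=> a M HM _ _; apply: tense_necF.
- by move=> a M HM _ _; apply: tense_necP.
Qed.

Lemma tau_transl (L : rule bform -> Prop) q : L q -> tau L (rule_transl q).
Proof. by move=> Lq M HM _ TM; apply: TM; exists q. Qed.

Lemma tau_sub (L : rule bform -> Prop) M : tense_rule_system M ->
  (forall q, L q -> M (rule_transl q)) -> forall r, tau L r -> M r.
Proof.
move=> HM LM r; apply=> // [q|_ [q Lq ->]]; last exact: LM.
exact.
Qed.

Lemma tau_conservative L q : bsi_rule_system L ->
  tau L (rule_transl q) -> L q.
Proof.
case: q => G D HL tauq; apply: contrapT => nLq.
have entL := rule_system_entailment (bsi_rs HL).
have [|O [GO DO maxO]] :=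
    lindenbaum (P := fun a => a \in G) (Q := fun a => a \in D) entL.
  move=> G' D' GG' DD' LGD; apply/nLq/(ent_weak entL LGD).
    exact/fsubsetP.
  exact/fsubsetP.
have OT := maximal_bi_theory HL maxO.
have valid : gvalid (boolean_set (O := O)) (rule_transl (G, D)).
  move: tauq; apply: tau_sub.
    apply: gvalid_tense => [x a //|x y z xy yz a /xy/yz //|V a].
    exact: boolean_set_tsat.
  move=> [G1 D1] L1 V BV GV.
  (* Sending [p] to a formula defining the box of [V p] turns the translated rule under [V] into the
     instance of the rule by [s], to which maximality of [O] applies. *)
  have [s Vs] := choice (fun p => boolean_set_box OT (BV p)).
  have sat := prime_tsat OT Vs.
  have [|_ /imfsetP[a /= aD ->] Oa] := maximal_rule maxO (rs_subst (bsi_rs HL) s L1).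
    move=> _ /imfsetP[a /= aG ->]; apply/(prime_theorem OT) => x.
    by apply/sat/GV; exact: in_imfset.
  exists (transl a) => [|x]; first exact: in_imfset.
  by apply/sat; apply: (iffLR (prime_theorem OT _)) Oa x.
pose V p (x : prime_frame O) := sval x (BVar p).
have sat a x : tsat V (transl a) x <-> sval x a.
  have id_a : bsubst BVar a = a.
    by elim: a => //= [a -> b ->|a -> b ->|a -> b ->|a -> b ->].
  rewrite -{2}id_a; apply: prime_tsat => // p {}x; split=> [|xp y]; first by apply.
  exact.
have [p|_ /imfsetP[a /= /GO Oa ->] x|_ /imfsetP[a /= /DO nOa ->] Va] := valid V.
- exact: boolean_set_prime.
- by apply/sat; apply: (iffLR (prime_theorem OT _)) Oa x.
- by apply/nOa/(prime_theorem OT) => x; apply/sat.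
Qed.
(** * Completeness of the least tense companion *)

Record tense_theory (O : tform -> Prop) : Prop := TenseTheory {
  tt_thm : forall a, S4t a -> O a;
  tt_mp : forall a b, O (TImp a b) -> O a -> O b;
  tt_necF : forall a, O a -> O (TBoxF a);
  tt_necP : forall a, O a -> O (TBoxP a)
}.

Lemma maximal_tense_theory M O : tense_rule_system M -> maximal M O -> tense_theory O.
Proof.
move=> [_ thm mp necF necP] maxO; split.
- move=> a /thm Ma; have [c|b /[!inE]/eqP-> //] := maximal_rule maxO Ma.
  by rewrite inE.
- move=> a b Oab Oa; have [|c /[!inE]/eqP-> //] := maximal_rule maxO (mp a b).
  by move=> c /[!inE]/orP[]/eqP->.
- move=> a Oa; have [|c /[!inE]/eqP-> //] := maximal_rule maxO (necF a).
  by move=> c /[!inE]/eqP->.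
- move=> a Oa; have [|c /[!inE]/eqP-> //] := maximal_rule maxO (necP a).
  by move=> c /[!inE]/eqP->.
Qed.

(** * Subformulae and derivations in tense theories *)

Definition tchildren (a : tform) : seq tform :=
  match a with
  | TVar _ | TBot | TTop => [::]
  | TAnd a b | TOr a b => [:: a; b]
  | TNeg a | TBoxF a | TDiaP a => [:: a]
  end.

Fixpoint tsub (a : tform) : seq tform :=
  a :: match a with
       | TVar _ | TBot | TTop => [::]
       | TAnd a b | TOr a b => tsub a ++ tsub b
       | TNeg a | TBoxF a | TDiaP a => tsub a
       end.

Lemma tsub_refl a : a \in tsub a.
Proof. by case: a => *; rewrite /= inE eqxx. Qed.

Lemma tsub_children a b c : b \in tsub a -> c \in tchildren b -> c \in tsub a.
Proof.
have refl := tsub_refl.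
elim: a => [p|||a IHa d IHd|a IHa d IHd|a IHa|a IHa|a IHa] /=;
  rewrite in_cons => /predU1P[->|] //=;
  rewrite ?(in_cons, mem_cat) ?in_nil ?orbF.
- by case/orP=> /eqP->; rewrite refl ?orbT.
- by case/orP=> [/IHa H /H ->|/IHd H /H ->]; rewrite ?orbT.
- by case/orP=> /eqP->; rewrite refl ?orbT.
- by case/orP=> [/IHa H /H ->|/IHd H /H ->]; rewrite ?orbT.
- by move/eqP->; rewrite refl orbT.
- by move/IHa => H /H ->; rewrite orbT.
- by move/eqP->; rewrite refl orbT.
- by move/IHa => H /H ->; rewrite orbT.
- by move/eqP->; rewrite refl orbT.
- by move/IHa => H /H ->; rewrite orbT.
Qed.

Lemma tbeval_foldr_imp v c l :
  tbeval v (foldr TImp c l) = (all (tbeval v) l ==> tbeval v c).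
Proof. by elim: l => //= a l ->; case: (tbeval v a). Qed.

Ltac tautology_cases :=
  let v := fresh "v" in move=> v; rewrite /= ?andbT;
  repeat match goal with
  | |- context [tbeval v ?a] => case: (tbeval v a) => //=
  | |- context [v ?a] => case: (v a) => //=
  end.

Section TenseTheory.
Context (O : tform -> Prop) (OT : tense_theory O).

Lemma tt_taut (hs : seq tform) c : (forall h, h \in hs -> O h) ->
  (forall v, all (tbeval v) hs -> tbeval v c) -> O c.
Proof.
elim: hs c => [|h hs IH] c Ohs Hv.
  by apply: tt_thm => //; apply: S4t_taut => v; apply: Hv.
apply: (tt_mp OT (a := h)); last by apply: Ohs; rewrite inE eqxx.
apply: IH => [k khs|v Hhs]; first by apply: Ohs; rewrite inE khs orbT.
by rewrite /=; case vh: (tbeval v h) => //=; apply: Hv; rewrite /= vh.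
Qed.

Lemma tt_taut1 h c : O h -> (forall v, tbeval v h ==> tbeval v c) -> O c.
Proof.
move=> Oh Hv; apply: (@tt_taut [:: h]) => [k /[!inE]/eqP-> //|v /=].
by rewrite andbT; apply/implyP.
Qed.

Lemma tt_taut2 h k c : O h -> O k ->
  (forall v, [==> tbeval v h, tbeval v k => tbeval v c]) -> O c.
Proof.
move=> Oh Ok Hv; apply: (@tt_taut [:: h; k]) => [l /[!inE]/orP[]/eqP-> //|v /=].
by rewrite andbT => /andP[vh vk]; have := Hv v; rewrite vh vk.
Qed.

Lemma tt_taut3 h k l c : O h -> O k -> O l ->
  (forall v, [==> tbeval v h, tbeval v k, tbeval v l => tbeval v c]) -> O c.
Proof.
move=> Oh Ok Ol Hv; apply: (@tt_taut [:: h; k; l]) => [m|v /=].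
  by rewrite !inE => /or3P[]/eqP->.
by rewrite andbT => /and3P[vh vk vl]; have := Hv v; rewrite vh vk vl.
Qed.

Lemma tt_boxes (box : tform -> tform) c l : (forall a, O a -> O (box a)) ->
  (forall a b, O (TImp (box (TImp a b)) (TImp (box a) (box b)))) ->
  O (foldr TImp c l) -> O (foldr TImp (box c) (map box l)).
Proof.
move=> nec K /nec; apply: (tt_mp OT); elim: l => [|a l IH] /=.
  by apply: (@tt_taut [::]) => // v _ /=; rewrite orNb.
by apply: tt_taut2 (K a (foldr TImp c l)) IH _; tautology_cases.
Qed.

Lemma tt_dual1 a : O (TImp (TDiaP a) (TNeg (TBoxP (TNeg a)))).
Proof. exact/(tt_thm OT)/S4t_dual1. Qed.

Lemma tt_dual2 a : O (TImp (TNeg (TBoxP (TNeg a))) (TDiaP a)).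
Proof. exact/(tt_thm OT)/S4t_dual2. Qed.

Lemma tt_diaP_refl a : O (TImp a (TDiaP a)).
Proof.
apply: tt_taut2 (tt_thm OT (S4t_TP (TNeg a))) (tt_dual2 a) _; tautology_cases.
Qed.

Lemma tt_diaP_trans a : O (TImp (TDiaP (TDiaP a)) (TDiaP a)).
Proof.
have K : O (TImp (TBoxP (TBoxP (TNeg a))) (TBoxP (TNeg (TDiaP a)))).
  apply: (tt_mp OT (tt_thm OT (S4t_KP _ _))); apply: (tt_necP OT).
  by apply: tt_taut1 (tt_dual1 a) _; tautology_cases.
have K4 : O (TImp (TBoxP (TNeg a)) (TBoxP (TNeg (TDiaP a)))).
  by apply: tt_taut2 K (tt_thm OT (S4t_4P (TNeg a))) _; tautology_cases.
by apply: tt_taut3 K4 (tt_dual1 (TDiaP a)) (tt_dual2 a) _; tautology_cases.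
Qed.

Definition modal (a : tform) : bool :=
  match a with TBoxF _ | TDiaP _ => true | _ => false end.

(** Persistence of modal formulae, by [S4t_4F] or by [S4t_conv1] and transitivity of [TDiaP]; it is
    what lets them be read as upsets. *)
Lemma tt_modal a : modal a -> O (TImp a (TBoxF a)).
Proof.
case: a => // a _; first exact/(tt_thm OT)/S4t_4F.
have K : O (TImp (TBoxF (TDiaP (TDiaP a))) (TBoxF (TDiaP a))).
  apply: (tt_mp OT (tt_thm OT (S4t_KF _ _))); apply: (tt_necF OT).
  exact: tt_diaP_trans.
by apply: tt_taut2 K (tt_thm OT (S4t_conv1 (TDiaP a))) _; tautology_cases.
Qed.

End TenseTheory.

(** * Types, clusters and the bsi-rule describing them *)

Section Types.
Context (O : tform -> Prop) (OT : tense_theory O) (Th : {fset tform}).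
Context (Th_closed : forall a b, a \in Th -> b \in tchildren a -> b \in Th).

Definition type_of (v : tform -> bool) : {fset tform} :=
  [fset x in Th | tbeval v x].

Definition type_formula (t : {fset tform}) : tform :=
  foldr TAnd TTop [seq if x \in t then x else TNeg x | x <- enum_fset Th].

Lemma tbeval_type_formula v (t : {fset tform}) :
  t `<=` Th -> tbeval v (type_formula t) = (t == type_of v).
Proof.
move=> tTh; have -> : tbeval v (type_formula t) =
    all (fun x => (x \in t) == tbeval v x) (enum_fset Th).
  rewrite /type_formula; elim: (enum_fset Th) => //= x s ->.
  by case: (x \in t) => /=; case: (tbeval v x).
apply/allP/eqP => [H|-> x xTh]; last by rewrite !inE xTh.
apply/fsetP=> x; rewrite !inE; case xTh: (x \in Th); first exact/eqP/H.
by apply/negP=> /(fsubsetP tTh); rewrite xTh.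
Qed.

(** [O] speaks of all points of a model at once, so a type is realised unless [O] rules it out
    everywhere. *)
Definition realized (t : {fset tform}) : Prop :=
  t `<=` Th /\ ~ O (TNeg (type_formula t)).

Definition modal_part (t : {fset tform}) : {fset tform} := [fset x in t | modal x].

Definition var (x : tform) : bform := BVar (choice.pickle x).
Definition unvar (p : nat) : tform := odflt TTop (choice.unpickle p).

(* The variable [var x] stands for [x], which is provably equivalent to
   [TBoxF x] when [x] is modal. *)
Definition tr (a : bform) : tform := tsubst unvar (transl a).

Lemma tr_var x : tr (var x) = TBoxF x.
Proof. by rewrite /tr /= /unvar choice.pickleK. Qed.

Definition meet (s : seq bform) : bform := foldr BAnd BTop s.
Definition join (s : seq bform) : bform := foldr BOr BBot s.

Lemma tbeval_meet v s : tbeval v (tr (meet s)) = all (fun a => tbeval v (tr a)) s.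
Proof. by elim: s => //= a s <-. Qed.

Lemma tbeval_join v s : tbeval v (tr (join s)) = has (fun a => tbeval v (tr a)) s.
Proof. by elim: s => //= a s <-. Qed.

Lemma bsat_meet (X : kframe) (V : nat -> X -> Prop) s x :
  bsat V (meet s) x <-> forall a, a \in s -> bsat V a x.
Proof.
elim: s => [|a s IH] /=; first by split.
rewrite IH; split=> [[H1 H2] b|H].
  by rewrite inE => /predU1P[->|/H2].
by split=> [|b bs]; apply: H; rewrite inE ?eqxx ?bs ?orbT.
Qed.

Lemma bsat_join (X : kframe) (V : nat -> X -> Prop) s x :
  bsat V (join s) x <-> exists2 a, a \in s & bsat V a x.
Proof.
elim: s => [|a s IH] /=; first by split=> // -[].
rewrite IH; split=> [[Ha|[b bs Hb]]|[b]].
- by exists a => //; rewrite inE eqxx.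
- by exists b => //; rewrite inE bs orbT.
- by rewrite inE => /predU1P[->|bs Hb]; [left|right; exists b].
Qed.

(* The points forcing [above M] and not [outside M] are those at which the true
   modal formulae of [Th] are exactly the elements of [M]. *)
Definition above (M : {fset tform}) : bform := meet [seq var x | x <- enum_fset M].
Definition outside (M : {fset tform}) : bform :=
  join [seq var x | x <- enum_fset (modal_part Th `\` M)].
Definition avoid (M : {fset tform}) : bform := BImp (above M) (outside M).

(** The formula [tr (avoid M)] without its leading [TBoxF]: the current point does not have cluster
    [M]. *)
Definition tavoid (M : {fset tform}) : tform :=
  TOr (TNeg (tr (above M))) (tr (outside M)).

Definition cluster_list (P : {fset tform} -> Prop) : seq {fset tform} :=
  [seq M <- enum_fset (fpowerset (modal_part Th)) | `[<P M>]].

Lemma cluster_listP P M : reflect (M `<=` modal_part Th /\ P M) (M \in cluster_list P).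
Proof.
rewrite mem_filter; apply: (iffP andP) => [[/asboolP PM]|[MTh PM]].
  by rewrite fpowersetE.
by split; [apply/asboolP|rewrite fpowersetE].
Qed.

Definition is_cluster (M : {fset tform}) : Prop :=
  exists2 t, realized t & modal_part t = M.
Definition cluster_with (a : tform) (M : {fset tform}) : Prop :=
  exists t, [/\ realized t, modal_part t = M & a \in t].
Definition cluster_without (a : tform) (M : {fset tform}) : Prop :=
  exists t, [/\ realized t, modal_part t = M & a \notin t].

(** Existence of witnesses: where [TBoxF a] fails, some later cluster has a type without [a]; where
    [TDiaP a] holds, some earlier cluster has a type with [a]. *)
Definition premise (x : tform) : bform :=
  match x with
  | TBoxF a => BImp (meet [seq avoid M | M <- cluster_list (cluster_without a)]) (var x)
  | TDiaP a => BImp (var x) (join [seq BCoimp (above M) (outside M)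
                                  | M <- cluster_list (cluster_with a)])
  | _ => BTop
  end.

(* A poset refutes this rule exactly when it carries the skeleton of a model
   realising the types that [O] allows. *)
Definition type_rule : rule bform :=
  (seq_fset tt ([seq avoid M | M <- cluster_list (fun M => ~ is_cluster M)] ++
                [seq premise x | x <- enum_fset (modal_part Th)]),
   seq_fset tt [seq avoid M | M <- cluster_list is_cluster]).

(** For [tbeval], a modal [x] and [TBoxF x] are unrelated atoms. Faithful valuations identify them
    as far as [tavoid] can tell, and [modal_axioms] enforces this. *)
Definition faithful (v : tform -> bool) : Prop :=
  forall M, M `<=` modal_part Th ->
    tbeval v (tavoid M) = (modal_part (type_of v) != M).

Definition modal_axioms : seq tform :=
  [seq TImp x (TBoxF x) | x <- enum_fset (modal_part Th)] ++
  [seq TImp (TBoxF x) x | x <- enum_fset (modal_part Th)].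

Lemma modal_axioms_theory h : h \in modal_axioms -> O h.
Proof.
rewrite mem_cat => /orP[] /mapP[x xTh ->]; last exact/(tt_thm OT)/S4t_TF.
by apply: tt_modal => //; move: xTh; rewrite !inE => /andP[].
Qed.

Lemma faithful_axioms v : all (tbeval v) modal_axioms -> faithful v.
Proof.
rewrite all_cat !all_map => /andP[/allP H1 /allP H2] M MTh.
have box x : x \in modal_part Th -> v (TBoxF x) = tbeval v x.
  move=> xTh; have /= := H1 x xTh; have /= := H2 x xTh.
  by case: (v _); case: (tbeval v x).
rewrite /= /above /outside tbeval_meet tbeval_join all_map has_map -[LHS]negbK.
rewrite negb_or negbK; congr (~~ _); apply/andP/eqP.
  move=> [/allP HM /hasPn HC]; apply/fsetP => x; apply/idP/idP.
    rewrite !inE => /andP[/andP[xTh vx] mx]; apply: contraTT vx => nxM.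
    have xT : x \in modal_part Th by rewrite !inE xTh.
    rewrite -(box x xT); have := HC x; rewrite !inE nxM xTh mx => /(_ isT).
    by rewrite tr_var.
  move=> xM; have xT := fsubsetP MTh _ xM.
  have : tbeval v (tr (var x)) := HM x xM; rewrite tr_var /= (box x xT).
  by move: xT; rewrite !inE => /andP[-> ->] ->.
move=> eqM; split.
  apply/allP => x xM; have xT := fsubsetP MTh _ xM.
  rewrite -[preim _ _ _]/(tbeval v (tr (var x))).
  by move: xM; rewrite tr_var /= (box x xT) -eqM !inE => /andP[/andP[_ ->]].
apply/hasPn => x /fsetDP[xT]; rewrite -[preim _ _ _]/(tbeval v (tr (var x))) tr_var /= (box x xT) -eqM !inE.
by move: xT; rewrite !inE => /andP[-> ->]; rewrite andbT.
Qed.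

(** The finitely many negated descriptions of excluded types lie in [O], so they can join the
    hypotheses of a tautological consequence. Membership in [O] can thus be checked on realised
    types. *)
Lemma theory_types (hs : seq tform) c : (forall h, h \in hs -> O h) ->
  (forall v, faithful v -> realized (type_of v) -> all (tbeval v) hs -> tbeval v c) ->
  O c.
Proof.
move=> Ohs Hv; pose excluded := [seq TNeg (type_formula t) |
  t <- [seq t <- enum_fset (fpowerset Th) | `[<O (TNeg (type_formula t))>]]].
apply: (@tt_taut _ OT (hs ++ modal_axioms ++ excluded)) => [h|v].
  rewrite mem_cat => /orP[/Ohs //|]; rewrite mem_cat.
  case/orP=> [/modal_axioms_theory //|/mapP[t + ->]].
  by rewrite mem_filter => /andP[/asboolP].
rewrite all_cat => /andP[vhs]; rewrite all_cat.
move=> /andP[/faithful_axioms vf /allP vex]; apply: Hv => //.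
have tTh : type_of v `<=` Th by apply/fsubsetP=> x; rewrite !inE => /andP[].
split=> // Ot; have /vex : TNeg (type_formula (type_of v)) \in excluded.
  by apply: map_f; rewrite mem_filter fpowersetE tTh andbT; apply/asboolP.
by rewrite /= tbeval_type_formula // eqxx.
Qed.

Lemma realized_type (hs : seq tform) t : (forall h, h \in hs -> O h) ->
  realized t -> exists v, [/\ faithful v, all (tbeval v) hs & t = type_of v].
Proof.
move=> Ohs [tTh nOt]; apply: contrapT => H; apply/nOt/(theory_types Ohs) => v vf _ vhs.
rewrite /= tbeval_type_formula //; apply/negP => /eqP tv.
by apply: H; exists v.
Qed.

Lemma type_of_in v x : x \in Th -> (x \in type_of v) = tbeval v x.
Proof. by move=> xTh; rewrite !inE xTh. Qed.

Lemma modal_part_sub (t : {fset tform}) : t `<=` Th -> modal_part t `<=` modal_part Th.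
Proof.
by move=> /fsubsetP tTh; apply/fsubsetP => x; rewrite !inE => /andP[/tTh-> ->].
Qed.

Lemma realized_sub t : realized t -> t `<=` Th.
Proof. by case. Qed.

Lemma cluster_withoutP v a : a \in Th -> realized (type_of v) -> ~~ tbeval v a ->
  modal_part (type_of v) \in cluster_list (cluster_without a).
Proof.
move=> aTh rv nva; apply/cluster_listP; split.
  exact/modal_part_sub/realized_sub.
by exists (type_of v); split=> //; rewrite type_of_in.
Qed.

Lemma cluster_withP v a : a \in Th -> realized (type_of v) -> tbeval v a ->
  modal_part (type_of v) \in cluster_list (cluster_with a).
Proof.
move=> aTh rv va; apply/cluster_listP; split.
  exact/modal_part_sub/realized_sub.
by exists (type_of v); split=> //; rewrite type_of_in.
Qed.

Lemma premise_boxF a : TBoxF a \in Th -> O (tr (premise (TBoxF a))).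
Proof.
move=> bTh; have aTh : a \in Th by apply: Th_closed bTh _; rewrite inE.
(* A realised type outside every cluster that has a type without [a] must itself contain [a]. *)
have H : O (foldr TImp a [seq tavoid M | M <- cluster_list (cluster_without a)]).
  apply: (@theory_types [::]) => // v vf rv _.
  rewrite tbeval_foldr_imp; apply/implyP; apply: contraTT => nva.
  have Mv := cluster_withoutP aTh rv nva.
  apply/allPn; exists (tavoid (modal_part (type_of v))); first exact: map_f.
  by have /cluster_listP[MTh _] := Mv; rewrite vf // eqxx.
move/(tt_boxes OT (tt_necF OT) (fun a b => tt_thm OT (S4t_KF a b))): H => H.
(* The variable for [TBoxF a] translates to [TBoxF (TBoxF a)], hence the appeal to [S4t_4F]. *)
have -> : tr (premise (TBoxF a)) = TBoxF (TOr (TNeg (tr (meet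
    [seq avoid M | M <- cluster_list (cluster_without a)]))) (TBoxF (TBoxF a))).
  by rewrite -(tr_var (TBoxF a)).
apply: (tt_necF OT); apply: (tt_taut2 OT) H (tt_thm OT (S4t_4F a)) _ => v.
rewrite tbeval_foldr_imp [X in _ ==> _ ==> X]/= tbeval_meet !all_map.
pose b := all (fun M => v (TBoxF (tavoid M))) (cluster_list (cluster_without a)).
rewrite -[X in (X ==> _) ==> _]/b -[X in ~~ X]/b.
by case: b => //=; case: (v _) => //=; case: (v _).
Qed.

Lemma premise_diaP a : TDiaP a \in Th -> O (tr (premise (TDiaP a))).
Proof.
move=> dTh; have aTh : a \in Th by apply: Th_closed dTh _; rewrite inE.
pose E M := TAnd (tr (above M)) (TNeg (tr (outside M))).
pose Ms := cluster_list (cluster_with a).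
(* The contrapositive is derived, so that it can be boxed into the past. *)
have H : O (foldr TImp (TNeg a) [seq TNeg (E M) | M <- Ms]).
  apply: (@theory_types [::]) => // v vf rv _.
  rewrite tbeval_foldr_imp; apply/implyP; apply: contraTT => /negPn va.
  have Mv := cluster_withP aTh rv va.
  apply/allPn; exists (TNeg (E (modal_part (type_of v)))).
    exact: (map_f (fun M => TNeg (E M))).
  have /cluster_listP[MTh _] := Mv; have := vf _ MTh; rewrite eqxx /= => /negbT.
  by rewrite negb_or negbK negbK.
move/(tt_boxes OT (tt_necP OT) (fun a b => tt_thm OT (S4t_KP a b))): H => H.
have -> : tr (premise (TDiaP a)) = TBoxF (TOr (TNeg (TBoxF (TDiaP a))) (tr (join
    [seq BCoimp (above M) (outside M) | M <- Ms]))).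
  by rewrite -(tr_var (TDiaP a)).
(* [TBoxP (TNeg (E M))] hides the atom [TDiaP (TNeg (TNeg (E M)))], which only the duality axioms
   relate to [TDiaP (E M)]. *)
apply: (tt_necF OT); pose duals := [seq TImp (TNeg (TBoxP (TNeg (E M)))) (TDiaP (E M)) | M <- Ms].
apply: (@tt_taut _ OT [:: foldr TImp (TBoxP (TNeg a))
  (map TBoxP [seq TNeg (E M) | M <- Ms]), TImp (TDiaP a) (TNeg (TBoxP (TNeg a))),
  TImp (TBoxF (TDiaP a)) (TDiaP a) & duals]) => [h|v].
  rewrite !in_cons => /or4P[/eqP->|/eqP->|/eqP->|/mapP[M _ ->]] //.
  - exact: tt_dual1.
  - exact/(tt_thm OT)/S4t_TF.
  - exact: tt_dual2.
rewrite [all _ _]/= tbeval_foldr_imp => /and4P[vbox vdual vT /allP vduals].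
rewrite [tbeval _ _]/= tbeval_join has_map -implybE; apply/implyP => vb.
have va : v (TDiaP a) by move: vT; rewrite vb.
move: vdual vbox; rewrite /= va /= => /negPf->; rewrite implybF -!map_comp all_map.
case/allPn => M MMs /= vM; apply/hasP; exists M => //.
have /vduals : TImp (TNeg (TBoxP (TNeg (E M)))) (TDiaP (E M)) \in duals.
  exact: (map_f (fun M => TImp (TNeg (TBoxP (TNeg (E M)))) (TDiaP (E M)))).
by rewrite /= (negPf vM).
Qed.

Lemma theory_avoid M : M `<=` modal_part Th -> O (tr (avoid M)) <-> ~ is_cluster M.
Proof.
move=> MTh; split=> [Oavoid [t rt tM]|nM].
  have Oh : O (tavoid M) by apply: (tt_mp OT) Oavoid; apply/(tt_thm OT)/S4t_TF.
  have [|v [vf + tv]] := @realized_type [:: tavoid M] t _ rt.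
    by move=> h /[!inE]/eqP->.
  by rewrite all_seq1 (vf M MTh) -tv tM eqxx.
apply: (tt_necF OT); apply: (@theory_types [::] (tavoid M)) => // v vf rv _.
by rewrite (vf M MTh); apply/eqP => eM; apply: nM; exists (type_of v).
Qed.

Lemma type_rule_premises a : a \in type_rule.1 -> O (tr a).
Proof.
rewrite seq_fsetE mem_cat => /orP[/mapP[M /cluster_listP[MTh nM] ->]|].
  exact/theory_avoid.
case/mapP=> x; rewrite !inE => /andP[xTh]; case: x xTh => // x xTh _ ->.
  exact: premise_boxF.
exact: premise_diaP.
Qed.

Lemma type_rule_conclusions a : a \in type_rule.2 -> ~ O (tr a).
Proof.
by rewrite seq_fsetE => /mapP[M /cluster_listP[MTh cM] ->] /(theory_avoid MTh).
Qed.

(** * The model built over a poset refuting the type rule *)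

Section Countermodel.
Context (X : kframe) (V : nat -> X -> Prop).
Context (Xposet : is_poset X).
Context (Vup : forall p, upset (V p)).
Context (Vpremises : forall a, a \in type_rule.1 -> forall x, bsat V a x).
Context (Vconclusions : forall a, a \in type_rule.2 -> exists x, ~ bsat V a x).

Definition cluster_at (x : X) : {fset tform} :=
  [fset a in modal_part Th | `[<V (choice.pickle a) x>]].

Lemma cluster_at_in a x :
  (a \in cluster_at x) = (a \in modal_part Th) && `[<V (choice.pickle a) x>].
Proof. by rewrite in_fsetE. Qed.

Lemma cluster_at_sub x : cluster_at x `<=` modal_part Th.
Proof. by apply/fsubsetP => a; rewrite cluster_at_in => /andP[]. Qed.

Lemma cluster_at_mono x y : krel x y -> cluster_at x `<=` cluster_at y.
Proof.
move=> xy; apply/fsubsetP => a; rewrite !cluster_at_in => /andP[-> /asboolP Vx].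
by apply/asboolP; apply: Vup Vx.
Qed.

Lemma cluster_atP M x : M `<=` modal_part Th ->
  bsat V (above M) x /\ ~ bsat V (outside M) x <-> cluster_at x = M.
Proof.
move=> MTh; rewrite /above /outside bsat_meet bsat_join; split=> [[HM HC]|<-].
  apply/fsetP=> a; rewrite cluster_at_in; apply/andP/idP => [[aTh /asboolP Va]|aM].
    apply: contrapT => /negP naM; apply: HC; exists (var a) => //.
    by apply: map_f; rewrite inE naM.
  split; first exact: (fsubsetP MTh).
  by apply/asboolP; apply: (HM (var a)); apply: map_f.
split=> [_ /mapP[a + ->]|[_ /mapP[a + ->]]].
  by rewrite cluster_at_in => /andP[_ /asboolP].
by move=> /fsetDP[aTh]; rewrite cluster_at_in aTh => /negP H Va; apply/H/asboolP.
Qed.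

Lemma bsat_avoid M x : M `<=` modal_part Th ->
  bsat V (avoid M) x <-> forall y, krel x y -> cluster_at y <> M.
Proof.
move=> MTh; split=> [H y /H{}H /(cluster_atP _ MTh)[/H]//|H y /H nM ya].
by apply: contrapT => yo; apply/nM/cluster_atP.
Qed.

Lemma cluster_at_is_cluster x : is_cluster (cluster_at x).
Proof.
have [Xr _ _] := Xposet; have sub := cluster_at_sub x; apply: contrapT => nc.
have /Vpremises/(_ x)/(bsat_avoid _ sub)/(_ x (Xr x)) : avoid (cluster_at x) \in type_rule.1.
  by rewrite seq_fsetE mem_cat map_f //; apply/cluster_listP.
exact.
Qed.

Lemma cluster_at_surj M : M `<=` modal_part Th -> is_cluster M ->
  exists x, cluster_at x = M.
Proof.
move=> MTh cM; have /Vconclusions[x nx] : avoid M \in type_rule.2.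
  by rewrite seq_fsetE map_f //; apply/cluster_listP.
apply: contrapT => H; apply/nx/bsat_avoid => // y _ yM.
by apply: H; exists y.
Qed.

Lemma bsat_premise a x : a \in modal_part Th -> bsat V (premise a) x.
Proof.
by move=> aTh; apply: Vpremises; rewrite seq_fsetE mem_cat [X in _ || X]map_f ?orbT.
Qed.

Lemma modal_partE a : a \in Th -> modal a -> a \in modal_part Th.
Proof. by rewrite !inE => -> ->. Qed.

Lemma cluster_at_boxF a x : TBoxF a \in Th -> TBoxF a \notin cluster_at x ->
  exists y t, [/\ krel x y, realized t, modal_part t = cluster_at y & a \notin t].
Proof.
have [Xr _ _] := Xposet.
move=> bTh; have bT := modal_partE bTh isT; rewrite cluster_at_in bT => /asboolPn nVx.
apply: contrapT => H; apply: nVx; apply: (bsat_premise x bT) (Xr x) _.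
apply/bsat_meet => _ /mapP[M /cluster_listP[MTh [t [rt tM nat]]] ->].
by apply/bsat_avoid => // y xy yM; apply: H; exists y, t; split; rewrite ?yM.
Qed.

Lemma cluster_at_diaP a x : TDiaP a \in cluster_at x ->
  exists y t, [/\ krel y x, realized t, modal_part t = cluster_at y & a \in t].
Proof.
have [Xr _ _] := Xposet; rewrite cluster_at_in => /andP[dT /asboolP Vx].
have /bsat_join[_ /mapP[M /cluster_listP[MTh [t [rt tM at_]]] ->]] :=
  bsat_premise x dT x (Xr x) Vx.
move=> [y [yx ya yo]]; exists y, t; split=> //.
by rewrite tM; apply/esym/cluster_atP.
Qed.

Definition blowup : kframe :=
  @KFrame {xt : X * {fset tform} | realized xt.2 /\ modal_part xt.2 = cluster_at xt.1}
    (fun u u' => krel (sval u).1 (sval u').1).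

Definition blowup_proj (u : blowup) : X := (sval u).1.

Lemma blowup_skeleton : skeleton blowup_proj.
Proof.
split=> // x; have [t rt tx] := cluster_at_is_cluster x.
by exists (exist _ (x, t) (conj rt tx)).
Qed.

Definition blowup_val (p : nat) (u : blowup) : Prop := TVar p \in (sval u).2.

(** Truth lemma. The premises of the rule supply the modal witnesses; the other directions combine
    monotonicity of [cluster_at] with reflexivity of the modalities inside a realised type. *)
Lemma blowup_tsat a u : a \in Th -> tsat blowup_val a u <-> a \in (sval u).2.
Proof.
have modal_type y t b : realized t -> modal_part t = cluster_at y -> modal b ->
    (b \in t) = (b \in cluster_at y).
  by move=> rt <- mb; rewrite !inE mb andbT.
have implied t b c : realized t -> b \in Th -> c \in Th -> O (TImp b c) ->
    b \in t -> c \in t.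
  move=> rt bTh cTh Obc; have [|v [_ + ->]] := @realized_type [:: TImp b c] t _ rt.
    by move=> h /[!inE]/eqP->.
  by rewrite /= andbT !type_of_in //; case: (tbeval v b).
have typeE t : realized t -> exists v, t = type_of v.
  by move=> rt; have [//|v [_ _ ->]] := @realized_type [::] t _ rt; exists v.
elim: a u => [p|||a IHa b IHb|a IHa b IHb|a IHa|a IHa|a IHa] u aTh;
  have [/typeE[v uv] _] := svalP u.
- by [].
- by rewrite uv type_of_in.
- by rewrite uv type_of_in.
- rewrite /= IHa ?IHb; try by apply: Th_closed aTh _; rewrite !inE eqxx ?orbT.
  rewrite uv !type_of_in //; try by apply: Th_closed aTh _; rewrite !inE eqxx ?orbT.
  by split=> /andP.
- rewrite /= IHa ?IHb; try by apply: Th_closed aTh _; rewrite !inE eqxx ?orbT.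
  rewrite uv !type_of_in //; try by apply: Th_closed aTh _; rewrite !inE eqxx ?orbT.
  by split=> /orP.
- rewrite /= IHa ?uv ?type_of_in //; try by apply: Th_closed aTh _; rewrite !inE eqxx.
  by split=> /negP.
- have {}IHa w : tsat blowup_val a w <-> a \in (sval w).2.
    by apply: IHa; apply: Th_closed aTh _; rewrite inE.
  have aT : a \in Th by apply: Th_closed aTh _; rewrite inE.
  case: u {v uv} => [[x t] [rt tx]] /=; split=> [H|ba [[y t'] [rt' ty']] /= xy].
    rewrite (modal_type x) //; apply: contrapT => /negP nb.
    have [y [t' [xy rt' ty' /negP nat']]] := cluster_at_boxF aTh nb.
    by apply/nat'/(IHa (exist _ (y, t') (conj rt' ty'))); apply: H.
  apply/IHa => /=; apply: (implied _ (TBoxF a)) => //; first exact/(tt_thm OT)/S4t_TF.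
  move: ba; rewrite (modal_type x t) // (modal_type y t') //.
  exact: (fsubsetP (cluster_at_mono xy)).
- have {}IHa w : tsat blowup_val a w <-> a \in (sval w).2.
    by apply: IHa; apply: Th_closed aTh _; rewrite inE.
  have aT : a \in Th by apply: Th_closed aTh _; rewrite inE.
  case: u {v uv} => [[x t] [rt tx]] /=; split=> [[[[y t'] [rt' ty']] /= yx /IHa /= at']|].
    rewrite (modal_type x) //; apply: (fsubsetP (cluster_at_mono yx)).
    by rewrite -(modal_type y t') //; apply: implied at'; rewrite //; apply: tt_diaP_refl.
  rewrite (modal_type x) // => /cluster_at_diaP[y [t' [yx rt' ty' at']]].
  by exists (exist _ (y, t') (conj rt' ty')) => //; apply/IHa.
Qed.

Lemma blowup_theory a : a \in Th -> O a -> forall u, tsat blowup_val a u.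
Proof.
move=> aTh Oa u; apply/blowup_tsat => //; have [rt _] := svalP u.
have [|v [_ + ->]] := @realized_type [:: a] _ _ rt; first by move=> h /[!inE]/eqP->.
by rewrite /= andbT type_of_in.
Qed.

(** Some realised type omits [a], and its cluster occurs in [X] because the conclusions of the rule
    fail. *)
Lemma blowup_nontheory a : a \in Th -> ~ O a -> exists u, ~ tsat blowup_val a u.
Proof.
move=> aTh nOa; apply: contrapT => H; apply: nOa.
apply: (@theory_types [::]) => // v _ rv _; apply: contrapT => /negP nva.
have tTh := modal_part_sub (realized_sub rv).
have [|x xM] := cluster_at_surj tTh; first by exists (type_of v).
apply: H; exists (exist _ (x, type_of v) (conj rv (esym xM))).
by move/(blowup_tsat _ aTh); rewrite /= type_of_in //; apply/negP.
Qed.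

End Countermodel.

End Types.

(** * Transfer of Kripke completeness *)

Lemma tau_refuted_by_skeleton L r : bsi_rule_system L -> ~ tau L r ->
  exists q, ~ L q /\ forall X, is_poset X -> ~ bvalid X q ->
    exists (F : kframe) (f : F -> X), skeleton f /\ ~ tvalid F r.
Proof.
case: r => G D HL nr; have HT := tau_tense L.
have entT := rule_system_entailment (tense_rs HT).
have [|O [GO DO maxO]] :=
    lindenbaum (P := fun a => a \in G) (Q := fun a => a \in D) entT.
  move=> G' D' GG' DD' TGD; apply: nr; apply: (ent_weak entT TGD); exact/fsubsetP.
have OT := maximal_tense_theory HT maxO.
pose Th := seq_fset tt (flatten [seq tsub a | a <- enum_fset (G `|` D)]).
have Th_closed a b : a \in Th -> b \in tchildren a -> b \in Th.
  rewrite !seq_fsetE => /flatten_mapP[c cGD ac] ba.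
  by apply/flatten_mapP; exists c => //; apply: tsub_children ba.
have GDTh a : a \in G `|` D -> a \in Th.
  by move=> aGD; rewrite seq_fsetE; apply/flatten_mapP; exists a => //; apply: tsub_refl.
exists (type_rule O Th); split=> [Lq|X Xposet nX].
  (* Were the type rule in [L], this instance of its translation would lead from [O] to its
     complement. *)
  have := rs_subst (tense_rs HT) unvar (tau_transl Lq).
  case/(maximal_rule maxO) => [_ /imfsetP[_ /= /imfsetP[a /= aG ->] ->]|].
    exact: type_rule_premises aG.
  move=> _ /imfsetP[_ /= /imfsetP[a /= aD ->] ->]; exact: type_rule_conclusions aD.
have [V [Vup [Vpre Vcon]]] : exists V : nat -> X -> Prop, (forall p, upset (V p)) /\
    (forall a, a \in (type_rule O Th).1 -> forall x, bsat V a x) /\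
    (forall a, a \in (type_rule O Th).2 -> exists x, ~ bsat V a x).
  apply: contrapT => H; apply: nX => V Vup Vpre; apply: contrapT => Vcon.
  apply: H; exists V; do 2!split=> //; move=> a aD; apply: contrapT => nx.
  by apply: Vcon; exists a => // x; apply: contrapT => nax; apply: nx; exists x.
exists (blowup O Th V), (@blowup_proj O Th X V); split.
  exact: blowup_skeleton.
move=> /(_ (@blowup_val O Th X V))[a aG u|b bD Hb].
  by apply: blowup_theory; rewrite ?GDTh ?inE ?aG //; apply: GO.
have [||u] := @blowup_nontheory O OT Th Th_closed X V Xposet Vup Vpre Vcon b.
- by rewrite GDTh // inE bD orbT.
- exact: DO.
- by apply; apply: Hb.
Qed.

(** Interpreting a variable as the set of successors of [x] turns [S4t_TF] and [S4t_4F] into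
    reflexivity and transitivity at [x]. *)
Lemma tense_frame_preorder (F : kframe) M : tense_rule_system M ->
  (forall r, M r -> tvalid F r) ->
  (forall x : F, krel x x) /\
  (forall x y z : F, krel x y -> krel y z -> krel x z).
Proof.
move=> HM FM.
have thm a : S4t a -> forall V x, tsat (F := F) V a x.
  move=> Sa V; have [|b /[!inE]/eqP-> //] := FM _ (tense_thm HM Sa) V.
  by move=> b; rewrite inE.
split=> [x|x y z xy yz].
  have /tsat_imp := thm _ (S4t_TF (TVar 0)) (fun _ => krel x) x.
  by apply=> y.
have /tsat_imp H := thm _ (S4t_4F (TVar 0)) (fun _ => krel x) x.
by apply: (H _ y xy z yz) => w.
Qed.

Theorem theorem4p48 (L : rule bform -> Prop) (HL : bsi_rule_system L) :
  bsi_kripke_complete L <-> tense_kripke_complete (tau L).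
Proof.
split=> [[C [Cposet LC]]|[C tauC]].
  (* All frames with a skeleton in [C]; the countermodels of [tau_refuted_by_skeleton] are among
     them. *)
  exists (fun F : kframe => exists (X : kframe) (f : F -> X), C X /\ skeleton f) => r; split.
    move=> taur F [X [f [CX skf]]]; have [Xr Xt _] := Cposet X CX.
    have [relf _] := skf; apply/gvalidT; move: taur; apply: tau_sub.
      apply: gvalid_tense => // [x|x y z /relf xy /relf yz]; first exact/relf/Xr.
      by apply/relf/(Xt _ _ _ xy yz).
    move=> q Lq; apply/gvalidT/(skeleton_valid skf); first exact: Cposet.
    by move/LC: Lq; apply.
  move=> valid; apply: contrapT => /(tau_refuted_by_skeleton HL)[q [nLq Hq]].
  apply/nLq/LC => X CX; apply: contrapT => nXq.
  have [F [f [skf]]] := Hq X (Cposet X CX) nXq.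
  by apply; apply: valid; exists X, f.
(* All poset skeletons of members of [C]. *)
exists (fun X => is_poset X /\ exists2 F : kframe, C F & exists f : F -> X, skeleton f).
split=> [X [] //|q]; split=> [Lq X [Xposet [F CF [f skf]]]|valid].
  by apply/(skeleton_valid skf q Xposet); apply: (iffLR (tauC _) (tau_transl Lq)).
apply: tau_conservative => //; apply/tauC => F CF.
have [|Fr Ft] := @tense_frame_preorder F (tau L) (tau_tense L).
  by move=> r /tauC; apply.
have [X [f [Xposet skf]]] := skeleton_exists Fr Ft.
apply/(skeleton_valid skf q Xposet)/valid; split=> //.
by exists F => //; exists f.
Qed.
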